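(* Let $(r_0,u_0)\in\mathcal{X}^n$ be such that $\Phi(r_0,u_0)<+\infty$. Then a generalized minimizing movement for $\Phi$ starting from $(r_0,u_0)$ exists.
   Context: Let $n>1$ be an integer, $\kappa>0$, $\omega_n$ the volume of the unit ball of $\mathbb{R}^n$, and $P_n(\rho)=n\omega_n\rho^{n-1}$. Let $\mathcal{C}_n=[0,\infty)$ (the radius $r$ represents the ball $B_r$ centred at $0$) with metric $\mathbf{d}(r_0,r_1)=\left|\int_{r_0}^{r_1}\sqrt{P_n(\rho)}\,d\rho\right|=\frac{2\sqrt{n\omega_n}}{n+1}\left|r_1^{(n+1)/2}-r_0^{(n+1)/2}\right|$. Let $L^1_n$ be the set of radially symmetric probability densities on $\mathbb{R}^n$, identified with measurable $u:(0,\infty)\to[0,\infty)$ with $\int_0^\infty uP_n\,d\rho=1$. Weak convergence $u_k\rightharpoonup u$ in $L^1_n$ means $\int_0^\infty u_kgP_n\,d\rho\to\int_0^\infty ugP_n\,d\rho$ for all $g\in L^\infty((0,\infty))$. $W_2$ is the quadratic Wasserstein distance between radial profiles, $W_2^2(u,w)=\int_0^1|F_u^{-1}(\sigma)-F_w^{-1}(\sigma)|^2\,d\sigma$ with $F_u(\rho)=\int_0^\rho uP_n$ and $F_u^{-1}(\sigma)=\sup\{\rho\ge0:F_u(\rho)\le\sigma\}$. State space: $\mathcal{X}^n=\{(r,u)\in\mathcal{C}_n\times L^1_n:\int_r^\infty uP_n\,d\rho=0\}$ with metric $\varrho((r,u),(s,w))=\left(\mathbf{d}^2(r,s)+\frac{W_2^2(u,w)}{\kappa}\right)^{1/2}$.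 Weak convergence $(r_k,u_k)\rightharpoonup(r,u)$ means $r_k\to r$ and $u_k\rightharpoonup u$. Let $f:[0,\infty)\to\mathbb{R}$ satisfy: $f(0)=0$, $\lim_{z\downarrow0}f(z)=0$, $f$ is strictly convex, $\lim_{z\to\infty}f(z)/z=+\infty$, $f$ is continuously differentiable on $(0,\infty)$, and (coercivity) $\lim_{z\downarrow0}z^{-1/n}f(z)=0$. Put $\mathcal{F}(u)=\int_0^\infty f(u(\rho))P_n(\rho)\,d\rho$ and $\Phi(r,u)=P_n(r)+\mathcal{F}(u)\in(-\infty,+\infty]$. Generalized minimizing movement: for a sequence $\boldsymbol\tau=(\tau_k)_{k\ge1}$ of positive time steps with $\sum_k\tau_k=+\infty$ and $|\boldsymbol\tau|:=\sup_k\tau_k<+\infty$, put $t^0_{\boldsymbol\tau}=0$, $t^k_{\boldsymbol\tau}=\sum_{j\le k}\tau_j$. A discrete solution associated to $\boldsymbol\tau$ is a map $\overline U_{\boldsymbol\tau}:[0,\infty)\to\mathcal{X}^n$ that is constant on each interval $(t^{k-1}_{\boldsymbol\tau},t^k_{\boldsymbol\tau}]$ and such that for every $k\ge1$ the point $\overline U_{\boldsymbol\tau}(t^k_{\boldsymbol\tau})$ minimizes $V\mapsto\Phi(V)+\frac1{2\tau_k}\varrho^2(\overline U_{\boldsymbol\tau}(t^{k-1}_{\boldsymbol\tau}),V)$ over $\mathcal{X}^n$. A curve $U:[0,\infty)\to\mathcal{X}^n$ is a generalized minimizing movement for $\Phi$ starting at $U_0$ if there are sequences $\boldsymbol\tau_j$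 of time steps with $|\boldsymbol\tau_j|\to0$ and associated discrete solutions with $\lim_j\Phi(\overline U_{\boldsymbol\tau_j}(0))=\Phi(U_0)$, $\limsup_j\varrho(\overline U_{\boldsymbol\tau_j}(0),U_0)<+\infty$, and $\overline U_{\boldsymbol\tau_j}(t)\rightharpoonup U(t)$ weakly in $\mathcal{X}^n$ for all $t\ge0$ as $j\to\infty$. *)

(* Defs.v *)
From HB Require Import structures.
From mathcomp Require Import all_boot all_order all_algebra.
From mathcomp Require Import all_classical all_reals all_analysis.

Set Implicit Arguments.
Unset Strict Implicit.
Unset Printing Implicit Defensive.

Import Order.TTheory GRing.Theory Num.Theory.
Import numFieldNormedType.Exports.

Local Open Scope classical_set_scope.
Local Open Scope ring_scope.

Section Volume.
Context {R : realType}.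
Local Notation mu := (@lebesgue_measure R).

(* Lebesgue measure of R^n as an iterated product measure: the successor case
   is product_measure1 (integral of the measures of the sections) for
   R^(n+1) = R x R^n. *)
Fixpoint volume (n : nat) : set (n.-tuple R) -> \bar R :=
  match n with
  | 0 => fun A => \d_ ([tuple] : 0.-tuple R) A
  | m.+1 => fun A =>
      (\int[mu]_t @volume m [set x : m.-tuple R | A (cons_tuple t x)])%E
  end.

Definition unit_ball (n : nat) : set (n.-tuple R) :=
  [set x | \sum_(i < n) tnth x i ^+ 2 <= 1].

Definition omega (n : nat) : R := fine (volume (@unit_ball n)).

Definition perim (n : nat) (rho : R) : R := n%:R * omega n * rho ^+ n.-1.

End Volume.

Section StateSpace.
Context {R : realType}.
Local Notation mu := (@lebesgue_measure R).

(* |\int_{r0}^{r1} sqrt P_n|, written over the unoriented interval. *)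
Definition dist_radius (n : nat) (r0 r1 : R) : R :=
  `| \int[mu]_(rho in `[Num.min r0 r1, Num.max r0 r1]) Num.sqrt (perim n rho) |.

(* Elements of L^1_n are given by representatives, of which only the values on
   ]0, +oo[ matter. *)
Definition radial_density (n : nat) (u : R -> R) : Prop :=
  [/\ measurable_fun (`]0, +oo[ : set R) u,
      forall rho, 0 < rho -> 0 <= u rho &
      (\int[mu]_(rho in `]0%R, +oo[) (u rho * perim n rho)%:E = 1)%E].

Definition essentially_bounded (g : R -> R) : Prop :=
  measurable_fun (`]0, +oo[ : set R) g /\
  exists M : R, {ae mu, forall rho, rho \in `]0, +oo[ -> `|g rho| <= M}.

Definition weak_cvg_density (n : nat) (u_ : nat -> R -> R) (u : R -> R) : Prop :=
  forall g : R -> R, essentially_bounded g ->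
    (\int[mu]_(rho in `]0%R, +oo[) (u_ k rho * g rho * perim n rho)%:E)%E
      @[k --> \oo] -->
    (\int[mu]_(rho in `]0%R, +oo[) (u rho * g rho * perim n rho)%:E)%E.

Definition cdf (n : nat) (u : R -> R) (rho : R) : R :=
  \int[mu]_(x in `]0, rho]) (u x * perim n x).

(* For sigma < 1 this set is bounded, so the supremum of R is the right one;
   hence W2 below integrates over the open unit interval. *)
Definition quantile (n : nat) (u : R -> R) (sigma : R) : R :=
  sup [set rho | 0 <= rho /\ cdf n u rho <= sigma].

Definition W2 (n : nat) (u w : R -> R) : \bar R :=
  ((\int[mu]_(s in `]0%R, 1%R[)
      (`|quantile n u s - quantile n w s| ^+ 2)%:E) `^ (2^-1)%R)%E.

Record state (n : nat) := State {
  ball_radius : R;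
  profile : R -> R;
  ball_radius_ge0 : 0 <= ball_radius;
  profileP : radial_density n profile;
  profile_supp :
    (\int[mu]_(rho in `]ball_radius, +oo[) (profile rho * perim n rho)%:E = 0)%E
}.

Definition state_dist (n : nat) (kappa : R) (U V : state n) : \bar R :=
  (((dist_radius n (ball_radius U) (ball_radius V) ^+ 2)%:E
    + W2 n (profile U) (profile V) ^+ 2 * (kappa^-1)%:E) `^ (2^-1)%R)%E.

Definition weak_cvg (n : nat) (U_ : nat -> state n) (U : state n) : Prop :=
  ball_radius (U_ k) @[k --> \oo] --> ball_radius U /\
  weak_cvg_density n (fun k => profile (U_ k)) (profile U).

End StateSpace.

Section Energy.
Context {R : realType}.
Local Notation mu := (@lebesgue_measure R).

Definition strictly_convex_on_nneg (f : R -> R) : Prop :=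
  forall x y t : R, 0 <= x -> 0 <= y -> x != y -> 0 < t -> t < 1 ->
    f (t * x + (1 - t) * y) < t * f x + (1 - t) * f y.

Record admissible_energy (n : nat) (f : R -> R) : Prop := {
  energy0 : f 0 = 0;
  energy_cvg0 : f z @[z --> 0^'+] --> (0 : R);
  energy_convex : strictly_convex_on_nneg f;
  energy_superlinear : f z / z @[z --> +oo] --> +oo;
  energy_derivable : forall z : R, 0 < z -> derivable f z 1;
  energy_C1 : forall z : R, 0 < z -> {for z, continuous (derive1 f)};
  energy_coercive : (z `^ (- n%:R^-1) * f z) @[z --> 0^'+] --> (0 : R)
}.

Definition internal_energy (n : nat) (f u : R -> R) : \bar R :=
  (\int[mu]_(rho in `]0%R, +oo[) (f (u rho) * perim n rho)%:E)%E.

Definition Phi (n : nat) (f : R -> R) (U : state n) : \bar R :=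
  ((perim n (ball_radius U))%:E + internal_energy n f (profile U))%E.

End Energy.

Section MinimizingMovements.
Context {R : realType}.

(* tau k is the (k+1)-st time step. *)
Definition time_steps (tau : nat -> R) : Prop :=
  [/\ forall k, 0 < tau k,
      series tau k @[k --> \oo] --> +oo &
      has_ubound (range tau)].

Definition mesh (tau : nat -> R) : R := sup (range tau).

Definition node (tau : nat -> R) (k : nat) : R := \sum_(j < k) tau j.

(* Curves [0, +oo[ -> state are functions on R whose values at negative times
   are irrelevant. *)
Definition discrete_solution (n : nat) (kappa : R) (f : R -> R)
    (tau : nat -> R) (U : R -> state n) : Prop :=
  (forall (k : nat) (s t : R),
     node tau k < s -> s <= node tau k.+1 ->
     node tau k < t -> t <= node tau k.+1 -> U s = U t) /\
  (forall (k : nat) (V : state n),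
     (Phi f (U (node tau k.+1))
        + ((2 * tau k)^-1)%:E
          * state_dist kappa (U (node tau k)) (U (node tau k.+1)) ^+ 2
      <= Phi f V
        + ((2 * tau k)^-1)%:E * state_dist kappa (U (node tau k)) V ^+ 2)%E).

Definition generalized_minimizing_movement (n : nat) (kappa : R) (f : R -> R)
    (U0 : state n) (U : R -> state n) : Prop :=
  exists (tau : nat -> nat -> R) (Ubar : nat -> R -> state n),
    [/\ (forall j, time_steps (tau j) /\
           discrete_solution kappa f (tau j) (Ubar j)),
        mesh (tau j) @[j --> \oo] --> (0 : R),
        Phi f (Ubar j 0%R) @[j --> \oo] --> Phi f U0,
        (limn_esup (fun j => state_dist kappa (Ubar j 0%R) U0) < +oo)%E &
        forall t : R, 0 <= t ->
          weak_cvg (fun j => Ubar j t) (U t)].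

End MinimizingMovements.

(* Main.v *)
(* A minimizing movement is built with the uniform time steps 1/(j+1).

   Compactness: the coercivity of f near 0 bounds the negative part of the
   internal energy by a small multiple of r^(n-1), so the perimeter term controls
   the radius on sublevels of Phi, and superlinearity of f makes the radial mass
   densities u P_n of a sublevel uniformly integrable.  If moreover the
   distribution functions converge pointwise, then by a Dynkin argument the masses
   of every measurable set converge, the limit is a measure by uniform
   integrability, and its Radon-Nikodym density is the weak limit.

   Minimizers: Phi is lower semicontinuous along weakly convergent sequences, by
   integrating the tangent inequality of f at the limit profile truncated to
   [1/j, j], and the distance to a fixed state is continuous, because quantiles
   converge at every level outside a countable set.

   Limit: the dissipation estimate makes the discrete solutions asymptotically
   equicontinuous in the radius and, through the L^1 distance of the quantiles, in
   the distribution functions.  A diagonal argument at rational times and radii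
   then gives convergence of these quantities at every time, and compactness
   applies. *)
From HB Require Import structures.
Require Import Defs.
From mathcomp Require Import all_boot all_order all_algebra.
From mathcomp Require Import all_classical all_reals all_analysis.
From mathcomp Require Import measurable_realfun ring lra.
Set Implicit Arguments.
Unset Strict Implicit.
Unset Printing Implicit Defensive.
Import Order.TTheory GRing.Theory Num.Theory.
Import numFieldNormedType.Exports.
Local Open Scope classical_set_scope.
Local Open Scope ring_scope.

(** * The energy density *)

(** The energy density may be negative near 0 and the radius is not bounded a priori, so a lower
    bound for [Phi] is not automatic. The exponent 1/n is the critical one: for unit mass on a ball
    of radius r, the integral of u^(1/n) against P_n is at most of order r^(n-1), which is the scale
    of the perimeter. A density that is o(z^(1/n)) near 0 therefore costs only a small fraction of
    the perimeter. Weak convergence is tested against all bounded measurable functions, whereas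
    pointwise limits of distribution functions alone give only narrow convergence. Uniform
    integrability closes this gap, and it also makes the distribution functions equicontinuous in
    the radius. The dissipation estimate controls sums of squared distances. It is converted into
    bounds on the distance of radii and on W_1, both with a plain triangle inequality, through x <=
    c + x^2/c with a free c. W_1 then controls distribution functions up to a small shift of the
    radius, which their equicontinuity absorbs. *)

Section EnergyFunction.
Context {R : realType} (n : nat) (f : R -> R).
Hypotheses (n_gt0 : (0 < n)%N) (hf : admissible_energy n f).
Local Notation f' := (derive1 f).

(** By convexity the difference quotients at [v] in the direction of [z] lie below the chord, and
    they come arbitrarily close to the derivative. The endpoint [z = 0], where [f] need not be
    differentiable, is included. *)
Lemma energy_tangent (v z : R) : 0 < v -> 0 <= z ->
  f v + f' v * (z - v) <= f z.
Proof.
move=> v0 z0; have [->|zv] := eqVneq z v; first by rewrite subrr mulr0 addr0.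
have zv0 : 0 < `|z - v| by rewrite normr_gt0 subr_eq0.
apply/ler_addgt0Pr => e e0.
have := energy_derivable hf v0; rewrite /derivable => dv.
have dcv : h^-1 *: (f (h *: 1 + v) - f v) @[h --> 0^'] --> f' v.
  by rewrite derive1E.
have e'0 : 0 < e / `|z - v| by rewrite divr_gt0.
move/cvgrPdist_le: dcv => /(_ _ e'0) [d /= d0 Hd].
(* The first bound keeps [t] below 1 for convexity; the second keeps the increment [t * (z - v)]
   within [d / 2] of 0. *)
pose t := Num.min (2^-1) (d / (2 * `|z - v|)).
have t0 : 0 < t by rewrite lt_min invr_gt0 ltr0n /= divr_gt0 // mulr_gt0.
have t1 : t < 1 by rewrite gt_min invf_lt1 ?ltr1n// ltr0n.
pose h := t * (z - v).
have h0 : h != 0 by rewrite mulf_neq0 ?(gt_eqF t0)// subr_eq0.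
have hd : ball (0 : R) d h.
  rewrite /ball/= sub0r normrN /h normrM gtr0_norm//.
  apply: (@le_lt_trans _ _ (d / 2)); last by rewrite ltr_pdivrMr// mulr_natr mulr2n ltrDl.
  rewrite -ler_pdivlMr// /t ge_min; apply/orP; right.
  by rewrite invfM mulrA.
have := Hd h hd h0.
have -> : h^-1 *: (f (h *: 1 + v) - f v) = (f (v + h) - f v) / h.
  by rewrite /GRing.scale/= mulrC mulr1 (addrC h).
have cv : f (v + h) < t * f z + (1 - t) * f v.
  have -> : v + h = t * z + (1 - t) * v by rewrite /h; lra.
  by apply: (energy_convex hf) => //; exact: ltW.
have -> : f' v - (f (v + h) - f v) / h = (f' v * h - (f (v + h) - f v)) / h.
  by field.
rewrite normrM normfV ler_pdivrMr ?normr_gt0//.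
have -> : e / `|z - v| * `|h| = t * e.
  by rewrite /h normrM (gtr0_norm t0); field; rewrite gt_eqF.
move=> /(le_trans (ler_norm _)) H.
rewrite -(ler_pM2l t0); rewrite /h in H.
nra.
Qed.

Lemma energy_superlinear_ge (L : R) : exists2 M : R, 0 < M &
  forall z, M <= z -> L * z <= f z.
Proof.
have /cvgryPge/(_ L) [M [_ HM]] := energy_superlinear hf.
exists (Num.max M 0 + 1); first by rewrite ltr_wpDl// le_max lexx orbT.
move=> z zM.
have z0 : 0 < z by apply: lt_le_trans zM; rewrite ltr_wpDl// le_max lexx orbT.
rewrite -ler_pdivlMr//; apply: HM; apply: lt_le_trans zM.
by rewrite (@le_lt_trans _ _ (Num.max M 0)) ?ltrDl// le_max lexx.
Qed.

(** Superlinearity makes [f] nonnegative beyond some [M]; on [0, M] the tangent at 1 bounds it from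
    below. *)
Lemma energy_lbound : exists2 m : R, 0 <= m & forall z, 0 <= z -> - m <= f z.
Proof.
have [M M0 HM] := energy_superlinear_ge 0.
exists (`|f 1| + `|f' 1| * (1 + M)).
  by rewrite addr_ge0// mulr_ge0// addr_ge0// ltW.
move=> z z0; have [Mz|zM] := leP M z.
  have := HM _ Mz; rewrite mul0r; apply: le_trans.
  by rewrite oppr_le0 addr_ge0// mulr_ge0// addr_ge0// ltW.
apply: le_trans (energy_tangent ltr01 z0).
rewrite opprD lerD//; first by rewrite lerNl -normrN ler_norm.
rewrite lerNl -mulrN; apply: (le_trans (ler_norm _)); rewrite normrM ler_wpM2l//.
by rewrite ler_norml; apply/andP; split; lra.
Qed.

(** Coercivity gives the root term near 0. Away from 0 the constant lower bound of [f] is absorbed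
    into a multiple of [z], which integrates to a constant because profiles have mass one. *)
Lemma energy_lbound_root (e : R) : 0 < e ->
  exists2 C : R, 0 <= C & forall z, 0 <= z -> - (e * z `^ n%:R^-1 + C * z) <= f z.
Proof.
move=> e0; have [m m0 Hm] := energy_lbound.
have /cvgr0Pnorm_le /(_ _ e0) [d /= d0 Hd] := energy_coercive hf.
exists (m / (d / 2)); first by rewrite divr_ge0// divr_ge0// ltW.
move=> z z0; have [->|zn0] := eqVneq z 0.
  by rewrite (energy0 hf) mulr0 addr0 oppr_le0 mulr_ge0 ?powR_ge0// ltW.
have zp : 0 < z by rewrite lt_neqAle eq_sym zn0.
have [zd|dz] := ltP z d.
  have := Hd z; rewrite /ball/= sub0r normrN (gtr0_norm zp) => /(_ zd zp).
  rewrite normrM powRN gtr0_norm ?invr_gt0 ?powR_gt0//.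
  rewrite mulrC ler_pdivrMr ?powR_gt0// => H.
  rewrite lerNl; apply: (@le_trans _ _ (e * z `^ n%:R^-1)).
    by apply: le_trans H; rewrite -normrN ler_norm.
  by rewrite lerDl mulr_ge0// divr_ge0// divr_ge0// ltW.
apply: le_trans (Hm _ z0); rewrite lerN2 -[leLHS]add0r lerD//.
  by rewrite mulr_ge0 ?powR_ge0// ltW.
rewrite -mulrA ler_peMr// mulrC ler_pdivlMr ?divr_gt0// mul1r.
by apply: le_trans dz; rewrite ler_pdivrMr// ler_peMr ?ler1n// ltW.
Qed.

(** Let y be the n-th root of z. Either y <= 1/r, or r y > 1 and then y <= (r y)^(n-1) y = r^(n-1)
    z. This is a pointwise form of the Hölder estimate on the ball of radius [r]. *)
Lemma root_le_affine (r z : R) : 0 < r -> 0 <= z ->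
  z `^ n%:R^-1 <= r^-1 + r ^+ n.-1 * z.
Proof.
move=> r0 z0; have n0 : n%:R != 0 :> R by rewrite pnatr_eq0 -lt0n.
have [->|zn0] := eqVneq z 0.
  by rewrite powR0 ?invr_eq0// mulr0 addr0 invr_ge0 ltW.
have zp : 0 < z by rewrite lt_neqAle eq_sym zn0.
set y := z `^ _; have y0 : 0 < y by rewrite powR_gt0.
have zE : z = y ^+ n by rewrite /y -powR_mulrn ?powR_ge0// -powRrM mulVf// powRr1// ltW.
have [yr|ry] := leP y r^-1.
  by rewrite (le_trans yr)// lerDl mulr_ge0// exprn_ge0// ltW.
rewrite zE -{2}(prednK n_gt0) exprSr mulrA -exprMn -[leLHS]mul1r.
rewrite -[leLHS]add0r lerD ?invr_ge0 ?(ltW r0)//.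
rewrite ler_wpM2r ?(ltW y0)// exprn_ege1//.
by rewrite -(@mulfV _ r) ?gt_eqF// ler_wpM2l// ltW.
Qed.

(* With [e * r ^+ n.-1] as the slope and [e / r] as the constant, integration over
   the ball of radius [r] against [P_n] gives a bound of the order of [e * r ^+ n.-1],
   which the perimeter absorbs. *)
Lemma energy_lbound_affine (e : R) : 0 < e ->
  exists2 C : R, 0 <= C & forall r z, 0 < r -> 0 <= z ->
    - (e * r^-1 + (e * r ^+ n.-1 + C) * z) <= f z.
Proof.
move=> e0; have [C C0 HC] := energy_lbound_root e0; exists C => // r z r0 z0.
apply: le_trans (HC _ z0); rewrite lerN2.
have := root_le_affine r0 z0; nra.
Qed.

(** Nothing is known of [f] on negative numbers; precomposing with the positive part gives a
    function continuous on the whole line, from which measurability of [f] along a profile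
    follows. *)
Lemma continuous_energy_max0 : continuous (fun x : R => f (Num.max 0 x)).
Proof.
have ccl : continuous (fun x : R => Num.max 0 x).
  by move=> x; apply: (@continuous_max _ _ (cst 0) id x); [exact: cvg_cst|exact: cvg_id].
move=> x; have [x0|x0|->] := ltgtP x 0.
- apply: (@cvg_near_cst); near=> y.
  have y0 : y < 0 by near: y; exact: lt_nbhsl.
  by rewrite !max_l// ltW.
- apply: (@continuous_comp R R R (fun x => Num.max 0 x) f); first exact: ccl.
  rewrite max_r ?ltW//; apply: differentiable_continuous; apply/derivable1_diffP.
  exact: energy_derivable hf _ x0.
- apply/cvgrPdist_le => e e0; rewrite maxxx (energy0 hf).
  have /cvgr0Pnorm_le /(_ _ e0) [d /= d0 Hd] := energy_cvg0 hf.
  exists d => //= y; rewrite /ball/= sub0r normrN => yd.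
  rewrite sub0r normrN; have [y0|y0] := leP y 0.
    by rewrite (energy0 hf) normr0 ltW.
  by apply: Hd => //; rewrite /ball/= sub0r normrN.
Unshelve. all: by end_near. Qed.

Lemma continuous_derive_clamp (a b : R) : 0 < a -> a <= b ->
  continuous (fun x : R => f' (Num.max a (Num.min b x))).
Proof.
move=> a0 ab x.
apply: (@continuous_comp R R R (fun x => Num.max a (Num.min b x)) f').
  apply: (@continuous_max _ _ (cst a) (fun x => Num.min b x) x); first exact: cvg_cst.
  by apply: (@continuous_min _ _ (cst b) id x); [exact: cvg_cst|exact: cvg_id].
by apply: (energy_C1 hf); rewrite lt_max a0.
Qed.

End EnergyFunction.

(** * Setwise and weak convergence of densities *)

(** Such a sequence is Cauchy. This serves to pass from finite to countable unions, from rational to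
    real radii, and from rational to real times. *)
Lemma cvgn_unif_approx {R : realType} (x : nat -> R) :
  (forall e, 0 < e -> exists2 y : nat -> R, cvgn y &
     \forall k \near \oo, `|x k - y k| <= e) -> cvgn x.
Proof.
move=> H; apply/cauchy_cvgP/cauchyP => e e0.
have e20 : 0 < e / 2 by rewrite divr_gt0.
have [y yl xy] := H _ e20; exists (limn y).
move/cvgrPdist_lt : yl => /(_ _ e20) yl.
suff: \forall k \near \oo, ball (limn y) e (x k) by [].
near=> k; rewrite /ball/= -(subrK (y k) (limn y)) -addrA (splitr e).
apply: le_lt_trans (ler_normD _ _) _; rewrite ltr_leD//; first by near: k.
by rewrite distrC; near: k.
Unshelve. all: by end_near. Qed.

Section Density.
Context {R : realType}.
Local Notation mu := (@lebesgue_measure R).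

(** Densities with respect to Lebesgue measure on the whole line; the weight P_n will be absorbed
    into [w]. *)
Definition is_density (w : R -> R) : Prop :=
  [/\ measurable_fun setT w, forall x, 0 <= w x & (\int[mu]_x (w x)%:E = 1)%E].

Definition mass (w : R -> R) (A : set R) : R := fine (\int[mu]_(x in A) (w x)%:E).

Section Mass.
Variable w : R -> R.
Hypothesis hw : is_density w.

Let mw : measurable_fun setT w. Proof. by case: hw. Qed.
Let w0 x : 0 <= w x. Proof. by case: hw. Qed.

Lemma density_measurable (A : set R) : measurable A -> measurable_fun A (EFin \o w).
Proof. by move=> mA; apply/measurable_EFinP; exact: measurable_funTS. Qed.

Lemma mass_le1e (A : set R) : measurable A -> (\int[mu]_(x in A) (w x)%:E <= 1)%E.
Proof.
move=> mA; case: hw => _ _ <-; apply: ge0_subset_integral => //.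
  exact: density_measurable.
by move=> x _; rewrite lee_fin.
Qed.

Lemma massE (A : set R) : measurable A -> (mass w A)%:E = (\int[mu]_(x in A) (w x)%:E)%E.
Proof.
move=> mA; rewrite fineK// ge0_fin_numE; last by apply: integral_ge0 => x _; rewrite lee_fin.
by apply: le_lt_trans (mass_le1e mA) _; rewrite ltry.
Qed.

Lemma mass_ge0 (A : set R) : 0 <= mass w A.
Proof. by apply: fine_ge0; apply: integral_ge0 => x _; rewrite lee_fin. Qed.

Lemma mass_le1 (A : set R) : measurable A -> mass w A <= 1.
Proof. by move=> mA; rewrite -lee_fin massE// mass_le1e. Qed.

Lemma massT : mass w setT = 1.
Proof. by rewrite /mass; case: hw => _ _ ->. Qed.

Lemma le_mass (A B : set R) : measurable A -> measurable B -> A `<=` B ->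
  mass w A <= mass w B.
Proof.
move=> mA mB AB; rewrite -lee_fin !massE//; apply: ge0_subset_integral => //.
  exact: density_measurable.
by move=> x _; rewrite lee_fin.
Qed.

Lemma massU (A B : set R) : measurable A -> measurable B -> [disjoint A & B] ->
  mass w (A `|` B) = mass w A + mass w B.
Proof.
move=> mA mB AB; apply: EFin_inj; rewrite EFinD !massE//; last exact: measurableU.
apply: ge0_integral_setU => //.
  by apply: density_measurable; exact: measurableU.
by move=> x _; rewrite lee_fin.
Qed.

Lemma mass0 : mass w set0 = 0.
Proof. by rewrite /mass integral_set0. Qed.

Lemma massC (A : set R) : measurable A -> mass w (~` A) = 1 - mass w A.
Proof.
move=> mA; rewrite -massT -(setUv A) massU//; first by rewrite addrC addKr.
  exact: measurableC.
by apply/disj_set2P; rewrite setICr.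
Qed.

Lemma mass_split_bigcup (F : nat -> set R) (N : nat) : (forall i, measurable (F i)) ->
  trivIset setT F ->
  mass w (\bigcup_i F i) = \sum_(i < N) mass w (F i) + mass w (\bigcup_(i >= N) F i).
Proof.
move=> mF tF; elim: N => [|N ->].
  rewrite big_ord0 add0r; congr mass; apply: eq_bigcupl; split => //.
rewrite big_ord_recr/= -addrA; congr (_ + _).
rewrite -massU//.
- congr mass; apply/seteqP; split => x.
    move=> [i /= Ni Fix]; have [iN|iN] := eqVneq i N; first by left; rewrite -iN.
    by right; exists i => //=; rewrite ltn_neqAle eq_sym iN.
  by move=> [Fx|[i /= Ni Fx]]; [exists N => /=|exists i => //=; exact: ltnW].
- by apply: bigcup_measurable.
- apply/disj_set2P/seteqP; split => x //= [FNx [i /= Ni Fix]].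
  have := tF N i I I; rewrite /= => /(_ _)/esym iN.
  suff : i = N by move=> iN'; rewrite iN' ltnn in Ni.
  by apply: iN; exists x.
Qed.

End Mass.

(** * Setwise limits of uniformly integrable densities *)

Section SetwiseLimit.
Variables (w : nat -> R -> R) (K : set R).
Hypotheses (hw : forall k, is_density (w k)) (mK : measurable K) (muK : (mu K < +oo)%E).
(** Only the part of [A] inside [K] is measured, so this contains tightness as well: a set disjoint
    from [K] has mass at most every positive [e]. *)
Hypothesis w_ui : forall e, 0 < e -> exists2 d, 0 < d & forall A, measurable A ->
  (mu (A `&` K) < d%:E)%E -> forall k, mass (w k) A <= e.

Lemma mass_bigcup_unif (F : nat -> set R) (e : R) : (forall i, measurable (F i)) ->
  trivIset setT F -> 0 < e -> \forall N \near \oo, forall k,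
  `|mass (w k) (\bigcup_i F i) - \sum_(i < N) mass (w k) (F i)| <= e.
Proof.
move=> mF tF e0; have [d d0 Hd] := w_ui e0.
pose D N := \bigcup_(i >= N) F i.
have mD N : measurable (D N) by apply: bigcup_measurable.
have D0 : \bigcap_N (D N `&` K) = set0.
  rewrite -subset0 => x Dx; have [[i _ Fix] _] := Dx 0%N I.
  have [[j /= ij Fjx] _] := Dx i.+1 I.
  have : i = j by apply: tF I I _; exists x.
  by move=> ijE; rewrite ijE ltnn in ij.
have : (mu (D N `&` K))%E @[N --> \oo] --> (mu (\bigcap_N (D N `&` K)))%E.
  apply: nonincreasing_cvg_mu.
  - apply: le_lt_trans muK; apply: le_measure; rewrite ?inE//.
    by apply: measurableI; [exact: mD|exact: mK].
  - by move=> N; apply: measurableI; [exact: mD|exact: mK].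
  - by rewrite D0.
  - move=> a b ab; apply/subsetPset; apply: setSI => x [i /= bi Fx].
    by exists i => //=; exact: leq_trans bi.
rewrite D0 measure0 => /fine_cvgP[finD /cvgr0Pnorm_lt/(_ _ d0) Dd].
near=> N => k.
rewrite (mass_split_bigcup (hw k) N mF tF) addrC addKr ger0_norm; last exact: mass_ge0.
apply: (Hd _ (mD N)); rewrite -[ltLHS]fineK; last by near: N.
rewrite lte_fin; apply: le_lt_trans (ler_norm _) _.
by near: N.
Unshelve. all: by end_near. Qed.

Hypothesis w_tail : forall x, cvgn (fun k => mass (w k) `]x, +oo[%classic).

Lemma mass_cvg (A : set R) : measurable A -> cvgn (fun k => mass (w k) A).
Proof.
move=> mA; pose P A := cvgn (fun k => mass (w k) A).
have mE : @measurable _ R = <<s @RGenOInfty.G R >> by exact: RGenOInfty.measurableE.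
apply: (@dynkin_induction _ R (@RGenOInfty.G R) P) => //.
- move=> _ _ [x ->] [y ->]; exists (Num.max x y).
  by apply/seteqP; split => z /=; rewrite !in_itv/= !andbT gt_max => /andP.
- rewrite /P (_ : (fun _ => _) = cst 1); first exact: is_cvg_cst.
  by apply/funext => k; rewrite massT.
- by move=> _ [x ->]; exact: w_tail.
- move=> S mS PS; rewrite /P (_ : (fun _ => _) = (fun k => 1 - mass (w k) S)).
    by apply: is_cvgB => //; exact: is_cvg_cst.
  by apply/funext => k; rewrite massC.
(* A single finite partial sum approximates the mass of the union for every [k], and its terms
   converge by induction. *)
- move=> F mF tF PF; apply: cvgn_unif_approx => e e0.
  have [N _ /(_ N (leqnn N)) HN] := mass_bigcup_unif mF tF e0.
  exists (fun k => \sum_(i < N) mass (w k) (F i)); last by near=> k; exact: HN.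
  elim: N {HN} => [|N IH].
    rewrite (_ : (fun k => \sum_(i < 0) mass (w k) (F i)) = cst 0); first exact: is_cvg_cst.
    by apply/funext => k; rewrite big_ord0.
  rewrite (_ : (fun _ => _) = 
    (fun k => \sum_(i < N) mass (w k) (F i)) \+ (fun k => mass (w k) (F N))).
    by apply: is_cvgD => //; exact: PF.
  by apply/funext => k; rewrite big_ord_recr.
- by rewrite -mE.
Unshelve. all: by end_near. Qed.

Let lmass (A : set R) : R := limn (fun k => mass (w k) A).

Let lmass_ge0 (A : set R) : measurable A -> 0 <= lmass A.
Proof.
by move=> mA; apply: limr_ge; [exact: mass_cvg|near=> k; exact: mass_ge0].
Unshelve. all: by end_near. Qed.

(* The maximum with 0 only matters on nonmeasurable sets, where the limit may be a
   junk value. *)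
Definition limit_mass (A : set (measurableTypeR R)) : \bar R :=
  (Num.max 0 (limn (fun k => mass (w k) A)))%:E.
Local Notation nu := limit_mass.

Let nuE (A : set R) : measurable A -> nu A = (lmass A)%:E.
Proof. by move=> mA; rewrite /limit_mass max_r// lmass_ge0. Qed.

Let lmass_const (A : set R) (c : R) : (forall k, mass (w k) A = c) -> lmass A = c.
Proof.
move=> Ac; rewrite /lmass (_ : (fun _ => _) = cst c) ?lim_cst//.
by apply/funext => k; exact: Ac.
Qed.

Let nu0 : nu set0 = 0%E.
Proof. by rewrite nuE// (@lmass_const _ 0)// => k; exact: mass0. Qed.

Let nu_ge0 (A : set R) : (0 <= nu A)%E.
Proof. by rewrite /limit_mass lee_fin le_max lexx. Qed.

Let lmass_sum (F : nat -> set R) (N : nat) : (forall i, measurable (F i)) ->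
  (fun k => \sum_(i < N) mass (w k) (F i)) @ \oo --> \sum_(i < N) lmass (F i).
Proof.
move=> mF; elim: N => [|N IH].
  by rewrite big_ord0 (_ : (fun _ => _) = cst 0) ?cvg_cst//; [exact: cvg_cst|];
    apply/funext => k; rewrite big_ord0.
rewrite big_ord_recr/= (_ : (fun _ => _) =
    
    (fun k => \sum_(i < N) mass (w k) (F i)) \+ (fun k => mass (w k) (F N))).
  by apply: cvgD => //; exact: mass_cvg.
by apply/funext => k; rewrite big_ord_recr.
Qed.

(** The bound on the remainder after [N] sets is uniform in [k], so it survives the limit in [k] for
    fixed [N]. *)
Let nu_sigma_additive : semi_sigma_additive nu.
Proof.
move=> F mF tF mUF; rewrite nuE//.
rewrite (_ : (fun _ => _) = EFin \o (fun n => \sum_(i < n) lmass (F i))); last first.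
  apply/funext => N /=; rewrite -sumEFin big_mkord.
  by apply: eq_bigr => i _; rewrite nuE//; exact: mF.
apply: cvg_EFin; first by near=> N.
apply/cvgrPdist_le => e e0; have := mass_bigcup_unif mF tF e0.
apply: filterS => N HN /=.
have : (fun k => `|mass (w k) (\bigcup_i F i) - \sum_(i < N) mass (w k) (F i)|) @ \oo -->
    `|lmass (\bigcup_i F i) - \sum_(i < N) lmass (F i)|.
  apply: cvg_norm; apply: cvgB; first exact: mass_cvg.
  exact: lmass_sum.
move=> cv; rewrite -(cvg_lim _ cv)//; apply: limr_le; first exact: cvgP cv.
by near=> k; exact: HN.
Unshelve. all: by end_near. Qed.

HB.instance Definition _ := isMeasure.Build _ _ _ nu nu0 nu_ge0 nu_sigma_additive.

Let nu_fin : fin_num_fun nu.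
Proof. by []. Qed.

HB.instance Definition _ := @Measure_isFinite.Build _ _ _ nu nu_fin.

Let nu_dom : nu `<< mu.
Proof.
apply/null_content_dominatesP => A mA muA0; rewrite nuE//; congr EFin.
apply/eqP; rewrite eq_le lmass_ge0// andbT; apply/ler_addgt0Pr => e e0; rewrite add0r.
have [d d0 Hd] := w_ui e0.
apply: limr_le; first exact: mass_cvg.
near=> k; apply: Hd => //; apply: le_lt_trans (_ : mu (A `&` K) <= mu A)%E _.
  by apply: le_measure; rewrite ?inE//; exact: measurableI.
by rewrite muA0 lte_fin.
Unshelve. all: by end_near. Qed.

Lemma setwise_limit_density : exists2 v : R -> R, is_density v &
  forall A, measurable A -> mass (w k) A @[k --> \oo] --> mass v A.
Proof.
pose nuM : {finite_measure set (measurableTypeR R) -> \bar R} := nu.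
have [h [h0 hfin ih nuh]] := @radon_nikodym_sigma_finite _ _ R mu nuM nu_dom.
have hE x : (fine (h x))%:E = h x by rewrite fineK.
have ihE (A : set R) : measurable A -> (\int[mu]_(x in A) h x)%E = (lmass A)%:E.
  by move=> mA; rewrite -nuh//; exact: nuE.
exists (fine \o h).
  split.
  - apply/measurable_EFinP; rewrite (_ : EFin \o _ = h); first exact: measurable_int ih.
    by apply/funext => x; exact: hE.
  - by move=> x; exact: fine_ge0.
  - under eq_integral do rewrite /= hE.
    by rewrite ihE// (@lmass_const _ 1)// => k; exact: massT.
move=> A mA; rewrite /mass; under [X in fine X]eq_integral do rewrite /= hE.
by rewrite ihE//=; exact: mass_cvg.
Qed.

End SetwiseLimit.
End Density.

Section WeightedIntegral.
Context {R : realType}.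
Local Notation mu := (@lebesgue_measure R).

Section OneDensity.
Variable w : R -> R.
Hypothesis hw : is_density w.

Let mw : measurable_fun setT w. Proof. by case: hw. Qed.
Let w0 x : 0 <= w x. Proof. by case: hw. Qed.
Let w1 : (\int[mu]_x (w x)%:E = 1)%E. Proof. by case: hw. Qed.

Lemma integrable_density : mu.-integrable setT (EFin \o w).
Proof.
apply/integrableP; split; first by apply/measurable_EFinP.
by under eq_integral do rewrite /= ger0_norm//; rewrite w1 ltry.
Qed.

Lemma integrable_density_mul (g : R -> R) (M : R) : measurable_fun setT g ->
  (forall x, `|g x| <= M) -> mu.-integrable setT (fun x => (w x * g x)%:E).
Proof.
move=> mg gM; apply: (@le_integrable _ _ R mu setT measurableT _ (fun x => (M * w x)%:E)) => //.
- by apply/measurable_EFinP; exact: measurable_funM.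
- move=> x _ /=; rewrite lee_fin !normrM mulrC (ger0_norm (w0 _)) ler_wpM2r//.
  exact: le_trans (gM x) (ler_norm _).
- under eq_fun do rewrite EFinM.
  by apply: integrableZl => //; exact: integrable_density.
Qed.

Lemma density_integral_ge0 (g : R -> R) : (forall x, 0 <= g x) ->
  (0 <= \int[mu]_x (w x * g x)%:E)%E.
Proof. by move=> g0; apply: integral_ge0 => x _; rewrite lee_fin mulr_ge0. Qed.

Lemma density_integral_le (g : R -> R) (M : R) : measurable_fun setT g ->
  (forall x, 0 <= g x <= M) -> (\int[mu]_x (w x * g x)%:E <= M%:E)%E.
Proof.
move=> mg gM; rewrite -[leRHS]mule1 -w1 -integralZl//; last exact: integrable_density.
apply: ge0_le_integral => //.
- by move=> x _; rewrite lee_fin mulr_ge0//; case/andP: (gM x).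
- by apply/measurable_EFinP; exact: measurable_funM.
- by apply: measurable_funeM; apply/measurable_EFinP.
- move=> x _; rewrite -EFinM lee_fin mulrC ler_wpM2r//.
  by case/andP: (gM x).
Qed.

Lemma density_integral_indic (A : set R) : measurable A ->
  (\int[mu]_x (w x * \1_A x)%:E = (mass w A)%:E)%E.
Proof.
move=> mA; rewrite massE// [RHS]integral_mkcond; apply: eq_integral => x _.
by rewrite patchE indicE; case: ifPn => xA; rewrite ?mulr1 ?mulr0.
Qed.

Lemma density_integral_halve (g : R -> R) (c : R) : measurable_fun setT g ->
  (forall x, 0 <= g x) -> 0 <= c ->
  let A := [set x | c <= g x] in
  (\int[mu]_x (w x * g x)%:E
   = c%:E * (mass w A)%:E + \int[mu]_x (w x * (g x - c * \1_A x))%:E)%E.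
Proof.
move=> mg g0 c0 A.
have mA : measurable A.
  by rewrite -[A]setTI; apply: measurable_fun_le => //; exact: measurable_cst.
have mi : measurable_fun setT (\1_A : R -> R) by exact: measurable_indic.
rewrite -density_integral_indic// -ge0_integralZl//; last 2 first.
- by apply/measurable_EFinP; exact: measurable_funM.
- by move=> x _; rewrite lee_fin mulr_ge0.
rewrite -ge0_integralD//.
- by apply: eq_integral => x _; rewrite -EFinM -EFinD; congr EFin; ring.
- by move=> x _; rewrite -EFinM lee_fin !mulr_ge0.
- by apply: measurable_funeM; apply/measurable_EFinP; exact: measurable_funM.
- move=> x _; rewrite lee_fin mulr_ge0// subr_ge0 indicE.
  by case: (boolP (x \in A)) => xA; rewrite ?mulr0// mulr1; move: xA; rewrite inE.
- apply/measurable_EFinP; apply: measurable_funM => //; apply: measurable_funB => //.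
  by apply: measurable_funM => //; exact: measurable_cst.
Qed.

End OneDensity.

(** * From masses of sets to integrals of bounded functions *)

Section SetwiseToWeak.
Variables (w : nat -> R -> R) (v : R -> R).
Hypotheses (hw : forall k, is_density (w k)) (hv : is_density v).
Hypothesis wv : forall A, measurable A -> mass (w k) A @[k --> \oo] --> mass v A.

Let L (u g : R -> R) : R := fine (\int[mu]_x (u x * g x)%:E)%E.

Let LE (u g : R -> R) (M : R) : is_density u -> measurable_fun setT g -> (forall x, `|g x| <= M) ->
  (\int[mu]_x (u x * g x)%:E = (L u g)%:E)%E.
Proof.
move=> hu mg gM; rewrite fineK//; apply: integrable_fin_num => //.
exact (integrable_density_mul hu mg gM).
Qed.

(* Each halving peels off the level set [g >= M/2], on which the hypothesis applies. *)
Let near_halved (N : nat) : forall (M : R) (g : R -> R), measurable_fun setT g ->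
  (forall x, 0 <= g x <= M) -> forall e, 0 < e ->
  \forall k \near \oo, `|L (w k) g - L v g| <= M / 2 ^+ N + e.
Proof.
elim: N => [|N IH] M g mg gM e e0.
  have H u : is_density u -> 0 <= L u g <= M.
    move=> hu; rewrite -!lee_fin -(@LE u g M)//; last first.
      by move=> x; case/andP: (gM x) => g0 ?; rewrite ger0_norm.
    rewrite density_integral_ge0//; last by move=> x; case/andP: (gM x).
    exact: density_integral_le.
  near=> k; rewrite expr0 divr1.
  have /andP[a b] := H _ (hw k); have /andP[c d] := H _ hv.
  by rewrite ler_norml; apply/andP; split; lra.
have M0 : 0 <= M by case/andP: (gM 0) => /le_trans; exact.
pose A := [set x | M / 2 <= g x].
have mA : measurable A.
  by rewrite -[A]setTI; apply: measurable_fun_le => //; exact: measurable_cst.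
pose h x := g x - M / 2 * \1_A x.
have mh : measurable_fun setT h.
  apply: measurable_funB => //; apply: measurable_funM => //; exact: measurable_indic.
have hM x : 0 <= h x <= M / 2.
  rewrite /h indicE; case: (boolP (x \in A)) => xA; case/andP: (gM x) => g0 gM'.
    by move: xA; rewrite inE /A/= mulr1 => xA; apply/andP; split; lra.
  move: xA; rewrite notin_setE /A/= mulr0 subr0 => /negP; rewrite -ltNge => /ltW ->.
  by rewrite g0.
have LD u : is_density u -> L u g = M / 2 * mass u A + L u h.
  move=> hu; apply: EFin_inj; rewrite EFinD EFinM -(@LE u h (M / 2))//; last first.
    by move=> x; case/andP: (hM x) => h0 ?; rewrite ger0_norm.
  rewrite -(@LE u g M)//; last first.
    by move=> x; case/andP: (gM x) => h0 ?; rewrite ger0_norm.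
  apply: density_integral_halve => //; first by move=> x; case/andP: (gM x).
  by rewrite divr_ge0.
have e20 : 0 < e / 2 by rewrite divr_gt0.
have IHh := IH _ _ mh hM _ e20.
have e30 : 0 < e / (M + 1) by rewrite divr_gt0// ltr_wpDl.
have /cvgrPdist_le/(_ _ e30) wvA := wv mA.
near=> k.
have IHk : `|L (w k) h - L v h| <= M / 2 / 2 ^+ N + e / 2 by near: k.
have wvAk : `|mass v A - mass (w k) A| <= e / (M + 1) by near: k.
rewrite !LD// opprD addrACA -mulrBr; apply: le_trans (ler_normD _ _) _.
rewrite normrM (ger0_norm (_ : 0 <= M / 2)) ?divr_ge0//.
rewrite exprS invfM mulrA.
have : M / 2 * `|mass (w k) A - mass v A| <= e / 2.
  rewrite distrC; apply: le_trans (ler_wpM2l _ wvAk) _; first by rewrite divr_ge0.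
  have M1 : 0 < M + 1 by rewrite ltr_wpDl.
  rewrite mulrA ler_pdivrMr//; nra.
lra.
Unshelve. all: by end_near. Qed.

Lemma setwise_weak_cvg (g : R -> R) (M : R) : measurable_fun setT g ->
  (forall x, `|g x| <= M) ->
  (\int[mu]_x (w k x * g x)%:E @[k --> \oo] --> \int[mu]_x (v x * g x)%:E)%E.
Proof.
move=> mg gM; have M0 : 0 <= M by exact: le_trans (gM 0).
(* The shift makes the test function nonnegative; since densities have mass one, it adds the same
   constant [M] to all the integrals. *)
pose h x := g x + M.
have mh : measurable_fun setT h by apply: measurable_funD => //; exact: measurable_cst.
have hM x : 0 <= h x <= 2 * M.
  by move: (gM x); rewrite /h ler_norml => /andP[a b]; apply/andP; split; lra.
have hM' x : `|h x| <= 2 * M by case/andP: (hM x) => h0 ?; rewrite ger0_norm.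
have LD u : is_density u -> L u h = L u g + M.
  move=> hu; apply: EFin_inj; rewrite EFinD -(@LE u h (2 * M))// -(@LE u g M)//.
  have -> : (M%:E = \int[mu]_x (M * u x)%:E)%E.
    under eq_integral do rewrite EFinM.
    rewrite integralZl//; last exact: integrable_density.
    by case: hu => _ _ ->; rewrite mule1.
  rewrite -integralD//.
  - by apply: eq_integral => x _; rewrite -EFinD; congr EFin; rewrite /h; ring.
  - exact (integrable_density_mul hu mg gM).
  - under eq_fun do rewrite EFinM.
    by apply: integrableZl => //; exact: integrable_density.
rewrite (LE hv mg gM) (_ : (fun _ => _) = EFin \o (fun k => L (w k) g)); last first.
  by apply/funext => k; rewrite (LE (hw k) mg gM).
apply: cvg_EFin; first by near=> k.
apply/cvgrPdist_le => e e0.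
have e20 : 0 < e / 2 by rewrite divr_gt0.
have [N HN] : exists N, 2 * M / 2 ^+ N <= e / 2.
  have := @cvg_geometric R (2 * M) (2^-1) _.
  rewrite ger0_norm ?invr_ge0// invf_lt1// ltr1n => /(_ isT)/cvgr0Pnorm_le/(_ _ e20)[N _ HN].
  exists N; have := HN N (leqnn N); rewrite /= exprVn.
  by apply: le_trans; exact: ler_norm.
have := near_halved N mh hM e20; apply: filterS => k.
rewrite !LD// distrC (_ : L v g + M - (L (w k) g + M) = L v g - L (w k) g) => [H|]; last lra.
by apply: le_trans H _; rewrite [leRHS](splitr e) lerD2r.
Unshelve. all: by end_near. Qed.

End SetwiseToWeak.
End WeightedIntegral.

(** * States and their internal energy *)

Section IntegralBoundedBelow.
Context {R : realType}.
Local Notation mu := (@lebesgue_measure R).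

(** The integral of [h] may be infinite, but its negative part is dominated by the integrable [g].
    Adding this negative part to both sides leaves only nonnegative integrands, and it can be
    cancelled afterwards because its integral is finite. *)
Lemma integral_add_bounded_below (D : set R) (h g : R -> R) : measurable D ->
  measurable_fun D h -> mu.-integrable D (EFin \o g) ->
  (forall x, D x -> 0 <= g x) -> (forall x, D x -> 0 <= h x + g x) ->
  (\int[mu]_(x in D) (h x + g x)%:E =
   \int[mu]_(x in D) (h x)%:E + \int[mu]_(x in D) (g x)%:E)%E.
Proof.
move=> mD mh ig g0 hg0.
have mg : measurable_fun D g by apply/measurable_EFinP; exact: measurable_int ig.
pose hp x := Num.max (h x) 0; pose hn x := Num.max (- h x) 0.
have mhp : measurable_fun D hp by apply: measurable_maxr => //; exact: measurable_cst.
have mhn : measurable_fun D hn.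
  by apply: measurable_maxr; [exact: measurableT_comp|exact: measurable_cst].
have E1 : (\int[mu]_(x in D) (h x)%:E
    = \int[mu]_(x in D) (hp x)%:E - \int[mu]_(x in D) (hn x)%:E)%E.
  rewrite integralE; congr (_ - _)%E; apply: eq_integral => x _.
    by rewrite funeposE/hp EFin_max.
  by rewrite funenegE/hn EFin_max.
have gfin : (\int[mu]_(x in D) (g x)%:E)%E \is a fin_num by exact: integrable_fin_num ig.
have hng : (\int[mu]_(x in D) (hn x)%:E <= \int[mu]_(x in D) (g x)%:E)%E.
  apply: ge0_le_integral => //.
  - by move=> x _; rewrite lee_fin le_max lexx orbT.
  - exact/measurable_EFinP.
  - exact/measurable_EFinP.
  - by move=> x Dx; rewrite lee_fin ge_max g0// andbT; have := hg0 _ Dx; lra.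
have nfin : (\int[mu]_(x in D) (hn x)%:E)%E \is a fin_num.
  rewrite ge0_fin_numE; last first.
    by apply: integral_ge0 => x _; rewrite lee_fin le_max lexx orbT.
  by apply: le_lt_trans hng _; rewrite ltey_eq gfin.
have E2 : (\int[mu]_(x in D) (h x + g x)%:E + \int[mu]_(x in D) (hn x)%:E
    = \int[mu]_(x in D) (hp x)%:E + \int[mu]_(x in D) (g x)%:E)%E.
  rewrite -!ge0_integralD//; first last.
  - exact/measurable_EFinP.
  - by move=> x _; rewrite lee_fin le_max lexx orbT.
  - by apply/measurable_EFinP; exact: measurable_funD.
  - exact/measurable_EFinP.
  - exact/measurable_EFinP.
  - by move=> x _; rewrite lee_fin le_max lexx orbT.
  apply: eq_integral => x _; rewrite -!EFinD; congr EFin; rewrite /hn /hp.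
  by case: (leP (- h x) 0) => ?; case: (leP (h x) 0) => ?; lra.
rewrite E1 -addeAC -E2 addeK//.
Qed.

Lemma integrable_scale (D : set R) (h : R -> R) (a : R) : measurable D ->
  mu.-integrable D (fun x => (h x)%:E) -> mu.-integrable D (fun x => (a * h x)%:E).
Proof.
move=> mD ih; rewrite (_ : (fun _ => _) = (fun x => a%:E * (h x)%:E)%E).
  exact: integrableZl.
by apply/funext => x; rewrite EFinM.
Qed.

Lemma integral_scale (D : set R) (h : R -> R) (a : R) : measurable D ->
  mu.-integrable D (fun x => (h x)%:E) ->
  (\int[mu]_(x in D) (a * h x)%:E = a%:E * \int[mu]_(x in D) (h x)%:E)%E.
Proof. by move=> mD ih; rewrite -integralZl//; apply: eq_integral => x _; rewrite EFinM. Qed.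

End IntegralBoundedBelow.

Section States.
Context {R : realType} (n : nat).
Local Notation mu := (@lebesgue_measure R).
Local Notation P := (@perim R n).

Lemma volume_ge0 (m : nat) (A : set (m.-tuple R)) : (0 <= volume A)%E.
Proof.
elim: m A => [|m IH] A /=; first exact: measure_ge0.
by apply: integral_ge0 => t _; exact: IH.
Qed.

Lemma continuous_perim : continuous P.
Proof.
move=> x; rewrite /perim; apply: cvgM; first exact: cvg_cst.
exact: exprn_continuous.
Qed.

Lemma measurable_perim (A : set R) : measurable_fun A P.
Proof.
by apply: measurable_funTS; apply: continuous_measurable_fun; exact: continuous_perim.
Qed.

Lemma perim_ge0 (x : R) : 0 <= x -> 0 <= P x.
Proof.
move=> x0; rewrite /perim mulr_ge0 ?exprn_ge0// mulr_ge0//.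
by apply: fine_ge0; exact: volume_ge0.
Qed.

Lemma le_perim (x y : R) : 0 <= x -> x <= y -> P x <= P y.
Proof.
move=> x0 xy; rewrite /perim ler_wpM2l//.
  by rewrite mulr_ge0//; apply: fine_ge0; exact: volume_ge0.
by rewrite lerXn2r ?nnegrE ?(le_trans x0).
Qed.

Lemma le_integral_perim (r : R) : 0 <= r ->
  (\int[mu]_(x in `]0%R, r]) (P x)%:E <= (r * P r)%:E)%E.
Proof.
move=> r0; apply: (@le_trans _ _ (\int[mu]_(x in `]0%R, r]) (cst (P r)%:E x))%E).
  apply: ge0_le_integral => //.
  - by move=> x /=; rewrite in_itv/= => /andP[x0 _]; rewrite lee_fin perim_ge0// ltW.
  - by apply/measurable_EFinP; exact: measurable_perim.
  - move=> x /=; rewrite in_itv/= => /andP[x0 xr].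
    by rewrite lee_fin le_perim// ltW.
rewrite integral_cst//= lebesgue_measure_itv/= lte_fin.
case: ifPn => _; last by rewrite mule0 lee_fin mulr_ge0// perim_ge0.
by rewrite oppr0 adde0 -EFinM lee_fin mulrC.
Qed.

Lemma integrable_perim (r : R) : mu.-integrable `]0%R, r] (EFin \o P).
Proof.
apply/integrableP; split; first by apply/measurable_EFinP; exact: measurable_perim.
have [r0|r0] := ltP r 0.
  by rewrite set_itv_ge ?integral_set0//= bnd_simp -leNgt ltW.
apply: le_lt_trans (ltry (r * P r)); apply: le_trans (le_integral_perim r0).
apply: ge0_le_integral => //.
- apply: measurableT_comp => //; apply/measurable_EFinP; exact: measurable_perim.
- by apply/measurable_EFinP; exact: measurable_perim.
- move=> x /=; rewrite in_itv/= => /andP[x0 _].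
  by rewrite lee_fin ger0_norm// perim_ge0// ltW.
Qed.

(** The law of the radius under the density [u], extended by 0 to the negative half-line. *)
Definition radial_mass_density (u : R -> R) : R -> R :=
  (fun x => u x * P x) \_ `]0, +oo[.

Section OneState.
Variable U : state (R := R) n.
Local Notation u := (profile U).
Local Notation r := (ball_radius U).
Local Notation w := (radial_mass_density (profile U)).

Let mu_ : measurable_fun (`]0, +oo[ : set R) u. Proof. by case: (profileP U). Qed.
Let u0 x : 0 < x -> 0 <= u x. Proof. by case: (profileP U) => _ + _; exact. Qed.

(** Read off from the existence of a state: if this constant vanished, P_n would be zero and no
    profile could have mass one. *)
Lemma omega_gt0 : 0 < n%:R * @omega R n.
Proof.
rewrite lt_neqAle mulr_ge0//; last by apply: fine_ge0; exact: volume_ge0.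
rewrite andbT; apply/eqP => c0; have [_ _] := profileP U.
under eq_integral do rewrite /perim -c0 mul0r mulr0.
by rewrite integral0 => /eqP; rewrite eq_sym onee_eq0.
Qed.

Lemma perim_gt0 (x : R) : 0 < x -> 0 < P x.
Proof. by move=> x0; rewrite /perim mulr_gt0 ?exprn_gt0// omega_gt0. Qed.

Lemma measurable_profile_perim (A : set R) : A `<=` `]0, +oo[ -> 
  measurable_fun A (fun x => u x * P x).
Proof.
move=> A0; apply: (measurable_funS _ A0) => //.
by apply: measurable_funM; [exact: mu_|exact: measurable_perim].
Qed.

Lemma radial_integralE (g : R -> R) :
  (\int[mu]_(x in `]0%R, +oo[) (u x * g x * P x)%:E = \int[mu]_x (w x * g x)%:E)%E.
Proof.
rewrite integral_mkcond; apply: eq_integral => x _.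
rewrite /radial_mass_density !patchE; case: ifPn => _; last by rewrite mul0r.
by rewrite mulrAC.
Qed.

Lemma is_density_radial : is_density w.
Proof.
split.
- by apply/(measurable_restrictT _ _).1 => //; exact: measurable_profile_perim.
- move=> x; rewrite /radial_mass_density patchE; case: ifPn => //.
  by rewrite inE/= in_itv/= andbT => x0; rewrite mulr_ge0 ?u0// perim_ge0// ltW.
- have [_ _ <-] := profileP U; rewrite [RHS]integral_mkcond.
  by apply: eq_integral => x _; rewrite /radial_mass_density !patchE; case: ifPn.
Qed.

Lemma mass_radial (A : set R) : measurable A -> A `<=` `]0, +oo[ ->
  (mass w A)%:E = (\int[mu]_(x in A) (u x * P x)%:E)%E.
Proof.
move=> mA A0; rewrite massE//; last exact: is_density_radial.
apply: eq_integral => x; rewrite inE => Ax.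
by rewrite /radial_mass_density patchE mem_set//; exact: A0.
Qed.

Lemma mass_radial_npos : mass w `]-oo, 0] = 0.
Proof.
rewrite /mass integral0_eq// => x /=; rewrite in_itv/= => x0.
by rewrite /radial_mass_density patchE memNset//= in_itv/= andbT; apply/negP; rewrite -leNgt.
Qed.

Lemma mass_radial_tail (x : R) : r <= x -> mass w `]x, +oo[ = 0.
Proof.
move=> rx; apply/eqP; rewrite eq_le mass_ge0; last exact: is_density_radial.
rewrite andbT -lee_fin mass_radial//; last first.
  move=> y /=; rewrite !in_itv/= !andbT; apply: le_lt_trans.
  exact: le_trans (ball_radius_ge0 U) rx.
rewrite -[leRHS](profile_supp U); apply: ge0_subset_integral => //.
- apply/measurable_EFinP; apply: measurable_profile_perim => y /=.
  by rewrite !in_itv/= !andbT; apply: le_lt_trans; exact: ball_radius_ge0.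
- move=> y /=; rewrite in_itv/= andbT => ry.
  have y0 : 0 < y by apply: le_lt_trans ry; exact: ball_radius_ge0.
  by rewrite lee_fin mulr_ge0 ?u0// perim_ge0// ltW.
- by move=> y /=; rewrite !in_itv/= !andbT; exact: le_lt_trans.
Qed.

(** Open upper rays are the generating sets of the Dynkin argument, so this is the form in which
    distribution functions enter it. It also covers negative [x], where the interval of integration
    is empty. *)
Lemma cdfE (x : R) : Defs.cdf n u x = 1 - mass w `]x, +oo[.
Proof.
have hw := is_density_radial.
have H : mass w `]-oo, x] = 1 - mass w `]x, +oo[.
  by rewrite -setCitvr massC// opprB addrCA subrr addr0.
rewrite -H /Defs.cdf /Rintegral; have [x0|x0] := leP x 0.
  rewrite set_itv_ge ?integral_set0/=; last by rewrite bnd_simp -leNgt.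
  apply/esym/eqP; rewrite eq_le mass_ge0// andbT -mass_radial_npos.
  by apply: le_mass => // y /=; rewrite !in_itv/= => /le_trans; exact.
rewrite -mass_radial//=; last by move=> y /=; rewrite !in_itv/= andbT => /andP[].
have -> : `]-oo, x]%classic = `]-oo, (0 : R)] `|` `]0, x].
  by rewrite -itv_bndbnd_setU//= bnd_simp ltW.
rewrite massU// ?mass_radial_npos ?add0r//.
apply/disj_set2P/seteqP; split => // y /= []; rewrite !in_itv/= => y0 /andP[y0' _].
by move: (lt_le_trans y0' y0); rewrite ltxx.
Qed.

Lemma ball_radius_gt0 : 0 < r.
Proof.
rewrite lt_neqAle ball_radius_ge0 andbT; apply/eqP => r0.
have hw := is_density_radial.
have := massC hw (measurable_itv `](0:R), +oo[).
rewrite setCitvr mass_radial_npos mass_radial_tail -?r0// subr0 => /eqP.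
by rewrite eq_sym oner_eq0.
Qed.

Lemma mass_radial_bounded (s : R) : r <= s -> mass w `]0, s] = 1.
Proof.
move=> rs; have s0 : 0 < s by exact: lt_le_trans ball_radius_gt0 rs.
have hw := is_density_radial.
have := cdfE s; rewrite (mass_radial_tail rs) subr0 => <-.
rewrite /Defs.cdf /Rintegral -mass_radial//.
by move=> y /=; rewrite !in_itv/= andbT => /andP[].
Qed.

(** The support condition only says that an integral vanishes; since the integrand is nonnegative
    and P_n is positive, the profile itself vanishes almost everywhere there. With [f 0 = 0] this
    confines the internal energy to a bounded interval. *)
Lemma profile_ae0 : {ae mu, forall x, `]r, +oo[%classic x -> u x = 0}.
Proof.
have D0 : `]r, +oo[ `<=` `](0:R), +oo[.
  by move=> y /=; rewrite !in_itv/= !andbT; apply: le_lt_trans; exact: ball_radius_ge0.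
have mf : measurable_fun `]r, +oo[ (EFin \o (fun x => u x * P x)).
  by apply/measurable_EFinP; exact: measurable_profile_perim.
have := ae_eq_integral_abs mu (measurable_itv `]r, +oo[) mf => -[+ _].
have -> : (\int[mu]_(x in `]r, +oo[) `|(EFin \o (fun x => u x * P x)%R) x| = 0)%E.
  rewrite -[RHS](profile_supp U); apply: eq_integral => x; rewrite inE => /D0/=.
  by rewrite in_itv/= andbT => x0; rewrite ger0_norm// mulr_ge0 ?u0// perim_ge0// ltW.
move=> /(_ erefl); apply: filterS => x Hx rx; have [] := Hx rx; move/eqP.
rewrite mulf_eq0 => /orP[/eqP//|]; rewrite gt_eqF// perim_gt0//.
by have := D0 _ rx; rewrite /= in_itv/= andbT.
Qed.

End OneState.

Section Energy.
Variable f : R -> R.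
Hypotheses (n_gt0 : (0 < n)%N) (hf : admissible_energy n f).

Lemma measurable_energy_profile (U : state (R := R) n) (A : set R) :
  measurable A -> A `<=` `]0, +oo[ ->
  measurable_fun A (fun x => f (profile U x)).
Proof.
move=> mA A0; have [mu_ u0 _] := profileP U.
apply: (eq_measurable_fun (fun x => f (Num.max 0 (profile U x)))).
  move=> x; rewrite inE => /A0 /=; rewrite in_itv/= andbT => x0.
  by rewrite max_r// u0.
apply: (@measurableT_comp _ _ _ _ _ _ (fun y : R => f (Num.max 0 y))).
  by apply: continuous_measurable_fun; exact: continuous_energy_max0 hf.
exact: measurable_funS mu_.
Qed.

Lemma internal_energy_restrict (U : state (R := R) n) (s : R) : ball_radius U <= s ->
  (internal_energy n f (profile U) = \int[mu]_(x in `]0%R, s]) (f (profile U x) * P x)%:E)%E.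
Proof.
move=> rs; rewrite /internal_energy.
have -> : `]0, s]%classic = `](0:R), +oo[ `&` `]-oo, s].
  apply/seteqP; split => x /=; rewrite !in_itv/= andbT; first by move/andP.
  by move=> [-> ->].
rewrite integral_mkcondr; apply: ae_eq_integral => //.
- apply/measurable_EFinP; apply: measurable_funM; last exact: measurable_perim.
  exact: measurable_energy_profile.
- apply/measurable_restrict => //; apply: (@measurable_funS _ _ _ _ `](0:R), +oo[) => //.
  apply/measurable_EFinP; apply: measurable_funM; last exact: measurable_perim.
  exact: measurable_energy_profile.
- apply: (@filterS _ _ (ae_filter_ringOfSetsType mu) _ _ _ (profile_ae0 U)).
  move=> x Hx x0; rewrite patchE; case: ifPn => // xs.
  rewrite Hx ?(energy0 hf) ?mul0r//= in_itv/= andbT; apply: le_lt_trans rs _.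
  by move: xs; rewrite notin_setE/= in_itv/= => /negP; rewrite -ltNge.
Qed.

(** Rewrites the energy, possibly infinite, as the integral of a nonnegative function. The term
    linear in the profile contributes exactly [b] because the mass is one, and [s] may be shared by
    many states. *)
Lemma internal_energy_add (U : state (R := R) n) (s a b : R) : 0 <= a -> 0 <= b ->
  (forall z, 0 <= z -> - (a + b * z) <= f z) -> ball_radius U <= s ->
  (internal_energy n f (profile U) + (a%:E * \int[mu]_(x in `]0%R, s]) (P x)%:E + b%:E) =
   \int[mu]_(x in `]0%R, s]) ((f (profile U x) + a + b * profile U x) * P x)%:E)%E.
Proof.
move=> a0 b0 fab rs; have [mu_ u0 _] := profileP U.
have D0 : `]0, s] `<=` `](0:R), +oo[ by move=> y /=; rewrite !in_itv/= andbT => /andP[].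
have iu : mu.-integrable `]0%R, s] (fun x => (profile U x * P x)%:E).
  apply/integrableP; split; first by apply/measurable_EFinP; exact: measurable_profile_perim.
  apply: (@le_lt_trans _ _ (mass (radial_mass_density (profile U)) `]0%R, s])%:E); last exact: ltry.
  rewrite mass_radial// le_eqVlt; apply/orP; left; apply/eqP.
  apply: eq_integral => x; rewrite inE => /D0/=.
  by rewrite in_itv/= andbT => x0; rewrite ger0_norm// mulr_ge0 ?u0// perim_ge0// ltW.
have iaP : mu.-integrable `]0%R, s] (fun x => (a * P x)%:E).
  by apply: integrable_scale => //; exact: integrable_perim.
have ibP : mu.-integrable `]0%R, s] (fun x => (b * (profile U x * P x))%:E).
  exact: integrable_scale.
have -> : (a%:E * \int[mu]_(x in `]0%R, s]) (P x)%:E + b%:E =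
    \int[mu]_(x in `]0%R, s]) (a * P x + b * (profile U x * P x))%:E)%E.
  under [RHS]eq_integral do rewrite EFinD.
  rewrite integralD//; congr (_ + _)%E.
    by rewrite [RHS]integral_scale//; exact: integrable_perim.
  by rewrite [RHS]integral_scale// -mass_radial// mass_radial_bounded// mule1.
rewrite (internal_energy_restrict rs) -integral_add_bounded_below//.
- by apply: eq_integral => x _; congr EFin; ring.
- apply: measurable_funM; last exact: measurable_perim.
  exact: measurable_energy_profile.
- rewrite [X in mu.-integrable _ X](_ : _ =
    (fun x => (a * P x)%:E) \+ (fun x => (b * (profile U x * P x))%:E))%E.
    exact: integrableD.
  by apply/funext.
- move=> x /D0/=; rewrite in_itv/= andbT => x0.
  have Px : 0 <= P x by exact: perim_ge0 (ltW x0).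
  have ux := u0 _ x0; apply: addr_ge0; first exact: mulr_ge0.
  by apply: mulr_ge0 => //; exact: mulr_ge0.
- move=> x /D0/=; rewrite in_itv/= andbT => x0.
  have Px : 0 <= P x by exact: perim_ge0 (ltW x0).
  have := fab _ (u0 _ x0) => H.
  have -> : f (profile U x) * P x + (a * P x + b * (profile U x * P x)) =
    (f (profile U x) + (a + b * profile U x)) * P x by ring.
  by rewrite mulr_ge0//; lra.
Qed.

End Energy.
End States.

(** * Weak compactness of sublevels *)

Section Compactness.
Context {R : realType} (n : nat) (f : R -> R).
Hypotheses (n_gt1 : (1 < n)%N) (hf : admissible_energy n f).
Hypothesis omega_pos : 0 < n%:R * @omega R n.
Local Notation mu := (@lebesgue_measure R).
Local Notation P := (@perim R n).
Local Notation state := (state (R := R) n).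
Local Notation dens U := (radial_mass_density n (profile U)).

Let n_gt0 : (0 < n)%N. Proof. exact: ltnW. Qed.

Lemma Phi_coercive : exists C : R, forall U : state,
  ((P (ball_radius U) / 2 - C)%:E <= Phi f U)%E.
Proof.
pose c := n%:R * @omega R n; have c0 : 0 < c by exact: omega_pos.
have c1 : 0 < c + 1 by rewrite addr_gt0.
(* With this slope e, the negative part costs at most (e/r) r P_n(r) + e r^(n-1) = e (c + 1)
   r^(n-1), up to the constant [C], and this is half of P_n(r). *)
have e0 : 0 < c / (2 * (c + 1)) by rewrite divr_gt0// mulr_gt0.
have [C C0 HC] := energy_lbound_affine n_gt0 hf e0.
exists C => U; set r := ball_radius U.
have r0 : 0 < r by exact: ball_radius_gt0.
set e := c / _ in e0 HC.
have a0 : 0 <= e / r by rewrite divr_ge0// ltW.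
have b0 : 0 <= e * r ^+ n.-1 + C.
  by rewrite addr_ge0// mulr_ge0 ?exprn_ge0// ltW.
have := internal_energy_add hf a0 b0 (fun z => HC r z r0) (lexx _ : ball_radius U <= r).
have IP := le_integral_perim n (ltW r0); have iP := integrable_perim n r.
have : (0 <= \int[mu]_(x in `]0%R, r]) (P x)%:E)%E.
  apply: integral_ge0 => x /=; rewrite in_itv/= => /andP[x0 _].
  by rewrite lee_fin perim_ge0// ltW.
have : (\int[mu]_(x in `]0%R, r]) (P x)%:E)%E \is a fin_num.
  exact: integrable_fin_num iP.
case: (\int[mu]_(x in `]0%R, r]) (P x)%:E)%E IP => // I; rewrite !lee_fin => IP _ I0.
rewrite -EFinM -EFinD => IE.
have : (0 <= internal_energy n f (profile U) + (e / r * I + (e * r ^+ n.-1 + C))%:E)%E.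
  rewrite IE; apply: integral_ge0 => x /=; rewrite in_itv/= => /andP[x0 _].
  rewrite lee_fin mulr_ge0 ?perim_ge0 ?(ltW x0)//.
  have [_ u0 _] := profileP U.
  by have := HC r _ r0 (u0 _ x0); rewrite -/e; lra.
have Ib : e / r * I + (e * r ^+ n.-1 + C) <= P r / 2 + C.
  rewrite addrA lerD2r.
  apply: (@le_trans _ _ (e / r * (r * P r) + e * r ^+ n.-1)).
    by rewrite lerD2r ler_wpM2l.
  rewrite le_eqVlt; apply/orP; left; apply/eqP.
  rewrite /perim -/c /e; field.
  by rewrite !gt_eqF.
rewrite /Phi -/r; case: (internal_energy _ _ _) => [y| |//].
- by rewrite -EFinD !lee_fin => H; lra.
- by move=> _; rewrite addey// leey.
Qed.

Lemma Phi_lbound : exists C : R, forall U : state, ((- C)%:E <= Phi f U)%E.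
Proof.
have [C HC] := Phi_coercive; exists C => U; apply: le_trans (HC U).
by rewrite lee_fin lerDr divr_ge0// perim_ge0// ball_radius_ge0.
Qed.

(** For r > 1 and n >= 2 the perimeter is at least n omega_n r, hence coercivity bounds the radius;
    for n = 1 the perimeter would be constant. *)
Lemma ball_radius_bounded (C : R) : exists2 R0 : R, 0 < R0 &
  forall U : state, (Phi f U <= C%:E)%E -> ball_radius U <= R0.
Proof.
have [C0 HC] := Phi_coercive.
exists (Num.max 1 (2 * (C + C0) / (n%:R * omega n))); first by rewrite lt_max ltr01.
move=> U /(le_trans (HC U)); rewrite lee_fin => H.
rewrite le_max; have [//|r1] := leP (ball_radius U) 1; rewrite /= ler_pdivlMr//.
have : n%:R * omega n * ball_radius U <= P (ball_radius U).
  rewrite /perim ler_pM2l// -[leLHS]expr1 ler_weXn2l ?(ltW r1)//.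
  by rewrite -ltnS prednK.
by rewrite mulrC; lra.
Qed.

Lemma mass_radial_setI (U : state) (s : R) (A : set R) : measurable A ->
  ball_radius U <= s -> mass (dens U) A = mass (dens U) (A `&` `]0, s]).
Proof.
move=> mA rs; have hw := is_density_radial U.
have mAs : measurable (A `&` `]0, s]) by exact: measurableI.
have mAs' : measurable (A `\` `]0, s]) by exact: measurableD.
rewrite -[in LHS](setUIDK A `]0, s]) massU//; last first.
  by apply/disj_set2P/seteqP; split => x //= [[? ?]] [].
rewrite [X in _ + X](_ : _ = 0) ?addr0//.
apply/eqP; rewrite eq_le mass_ge0// andbT.
have z : mass (dens U) (~` `]0, s]) = 0 by rewrite massC// mass_radial_bounded// subrr.
by rewrite -[leRHS]z; apply: le_mass => //; exact: measurableC.
Qed.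

(** The de la Vallée Poussin argument. Where the profile is below [M] its mass is at most M P_n(R0)
    times the measure of the set; where it is above [M], it is at most (f(u) + m)/L, whose integral
    is controlled by the energy. *)
Lemma mass_unif_integrable (C R0 : R) :
  (forall U : state, (Phi f U <= C%:E)%E -> ball_radius U <= R0) -> 0 < R0 ->
  forall e, 0 < e -> exists2 d, 0 < d & forall A, measurable A ->
    (mu (A `&` `]0%R, R0]) < d%:E)%E ->
    forall U : state, (Phi f U <= C%:E)%E -> mass (dens U) A <= e.
Proof.
move=> HR R00 e e0; have [m m0 Hm] := energy_lbound hf.
(* A bound for the integral of (f(u) + m) P_n over ]0, R0]. The choices of [L] and of the measure
   threshold below make each of the two contributions at most [e / 2]. *)
set K := `|C| + m * (R0 * P R0).
have PR : 0 <= P R0 by rewrite perim_ge0// ltW.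
have K0 : 0 <= K.
  by apply: addr_ge0 => //; apply: mulr_ge0 => //; apply: mulr_ge0 => //; exact: ltW.
have L0 : 0 < 2 * (K + 1) / e by rewrite divr_gt0// mulr_gt0// ltr_wpDl.
set L := 2 * (K + 1) / e in L0.
have [M M0 HM] := energy_superlinear_ge hf L.
have MP : 0 <= M * P R0 by rewrite mulr_ge0// ltW.
exists (e / (2 * (M * P R0 + 1))).
  by rewrite divr_gt0// mulr_gt0// ltr_wpDl.
move=> A mA Ad U UC; have rR := HR U UC.
have hw := is_density_radial U; have [mu_ u0 _] := profileP U.
rewrite (mass_radial_setI mA rR) -lee_fin.
set B := A `&` _ in Ad *.
have mB : measurable B by exact: measurableI.
have B0 : B `<=` `](0:R), +oo[ by move=> x [_ /=]; rewrite !in_itv/= andbT => /andP[].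
have D0 : `]0, R0] `<=` `](0:R), +oo[ by move=> y /=; rewrite !in_itv/= andbT => /andP[].
rewrite mass_radial//.
have HK : (\int[mu]_(x in `]0%R, R0]) ((f (profile U x) + m) * P x)%:E <= K%:E)%E.
  have Hm' z : 0 <= z -> - (m + 0 * z) <= f z by move=> z0; rewrite mul0r addr0; exact: Hm.
  have := internal_energy_add hf m0 (lexx 0) Hm' rR.
  under [X in _ = X -> _]eq_integral do rewrite mul0r addr0.
  move=> <-; apply: (@le_trans _ _ (C%:E + (m * (R0 * P R0))%:E)%E).
    apply: leeD; last first.
      by rewrite adde0 EFinM lee_wpmul2l// le_integral_perim// ltW.
    apply: le_trans UC; rewrite /Phi leeDr// lee_fin perim_ge0//.
    exact: ball_radius_ge0.
  by rewrite -EFinD lee_fin lerD2r ler_norm.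
have mh : measurable_fun `]0, R0] (fun x => (f (profile U x) + m) * P x).
  apply: measurable_funM; last exact: measurable_perim.
  apply: measurable_funD; last exact: measurable_cst.
  exact: measurable_energy_profile.
have h0 x : `]0, R0]%classic x -> 0 <= (f (profile U x) + m) * P x.
  move=> /D0/=; rewrite in_itv/= andbT => x0.
  by rewrite mulr_ge0 ?perim_ge0 ?(ltW x0)// -lerBlDr sub0r Hm// u0.
have BR : B `<=` `]0, R0] by move=> x [].
apply: (@le_trans _ _ (\int[mu]_(x in B) ((M * P R0)%:E +
    L^-1%:E * ((f (profile U x) + m) * P x)%:E))%E).
  apply: ge0_le_integral => //.
  - move=> x /B0/=; rewrite in_itv/= andbT => x0.
    by rewrite lee_fin mulr_ge0 ?u0// perim_ge0// ltW.
  - by apply/measurable_EFinP; exact: measurable_profile_perim.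
  - apply: emeasurable_funD; first exact: measurable_cst.
    apply: measurable_funeM; apply/measurable_EFinP.
    exact: measurable_funS mh.
  - move=> x Bx; have := B0 _ Bx; rewrite /= in_itv/= andbT => x0.
    have := BR _ Bx; rewrite /= in_itv/= => /andP[_ xR].
    rewrite -EFinM -EFinD lee_fin.
    have Px : 0 <= P x by rewrite perim_ge0// ltW.
    have PxR : P x <= P R0 by apply: le_perim => //; exact: ltW.
    apply: (@le_trans _ _ ((M + L^-1 * (f (profile U x) + m)) * P x)); last first.
      by rewrite mulrDl -mulrA lerD2r ler_wpM2l// ltW.
    rewrite ler_wpM2r//; have := u0 _ x0; set z := profile U x => z0.
    have [Mz|zM] := leP M z.
      have fz := HM _ Mz; rewrite -[leLHS]add0r lerD ?(ltW M0)//.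
      rewrite mulrC ler_pdivlMr// mulrC; lra.
    rewrite -[leLHS]addr0 lerD ?(ltW zM)// mulr_ge0 ?invr_ge0 ?(ltW L0)//.
    by have := Hm z z0; lra.
rewrite ge0_integralD//; last 2 first.
- move=> x /BR Rx; rewrite mule_ge0 ?lee_fin ?invr_ge0 ?(ltW L0)//.
  exact: h0.
- by apply: measurable_funeM; apply/measurable_EFinP; exact: measurable_funS mh.
rewrite integral_cst// ge0_integralZl//; last 3 first.
- by apply/measurable_EFinP; exact: measurable_funS mh.
- by move=> x /BR Rx; rewrite lee_fin h0.
- by rewrite lee_fin invr_ge0 ltW.
rewrite (splitr e) EFinD; apply: leeD.
  apply: le_trans (lee_wpmul2l _ (ltW Ad)) _; first by rewrite lee_fin.
  rewrite -EFinM lee_fin mulrA ler_pdivrMr ?mulr_gt0 ?ltr_wpDl//; nra.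
apply: (@le_trans _ _ (L^-1 * K)%:E).
  rewrite EFinM lee_wpmul2l ?lee_fin ?invr_ge0 ?(ltW L0)//.
  apply: le_trans HK; apply: ge0_subset_integral => //.
  exact/measurable_EFinP.
rewrite lee_fin /L invf_div mulrAC ler_pdivrMr ?mulr_gt0 ?ltr_wpDl//; nra.
Qed.

Lemma weak_cvg_density_setwise (U_ : nat -> state) (U : state) :
  (forall A, measurable A -> mass (dens (U_ k)) A @[k --> \oo] --> mass (dens U) A) ->
  weak_cvg_density n (fun k => profile (U_ k)) (profile U).
Proof.
move=> H g [mg [M0 gM]].
pose M := `|M0|.
(* The bound on [g] holds only almost everywhere; truncation makes it hold everywhere and changes
   [g] on a null subset of the half-line. *)
pose h := (fun x => Num.max (- M) (Num.min M (g x))) \_ `](0:R), +oo[.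
have mcl : measurable_fun (`](0:R), +oo[ : set R) (fun x => Num.max (- M) (Num.min M (g x))).
  apply: measurable_maxr; first exact: measurable_cst.
  by apply: measurable_minr => //; exact: measurable_cst.
have mh : measurable_fun setT h by apply/(measurable_restrictT _ _).1.
have hM x : `|h x| <= M.
  rewrite /h patchE; case: ifPn => _; last by rewrite normr0 /M.
  by rewrite ler_norml le_max lexx/= ge_max ge_min lexx/= andbT (ge0_cp (normr_ge0 M0)).2.
have E (V : state) : (\int[mu]_(x in `]0%R, +oo[) (profile V x * g x * P x)%:E =
    \int[mu]_x (dens V x * h x)%:E)%E.
  have -> : (\int[mu]_(x in `]0%R, +oo[) (profile V x * g x * P x)%:E =
      \int[mu]_x (dens V x * (g \_ `](0:R), +oo[) x)%:E)%E.
    rewrite radial_integralE; apply: eq_integral => x _; congr EFin.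
    by rewrite /radial_mass_density !patchE; case: ifPn => //; rewrite !mul0r.
  have [mV _ _] := is_density_radial V.
  apply: ae_eq_integral => //.
  - apply/measurable_EFinP; apply: measurable_funM => //.
    exact/(measurable_restrictT _ _).1.
  - by apply/measurable_EFinP; exact: measurable_funM.
  - apply: (@filterS _ _ (ae_filter_ringOfSetsType mu) _ _ _ gM) => x Hx _.
    congr (EFin (_ * _)); rewrite /h !patchE; case: ifPn => //; rewrite inE => /= x0.
    have := Hx x0 => /le_trans/(_ (ler_norm _)); rewrite -/M ler_norml => /andP[a b].
    by rewrite (min_idPr b) (max_idPr a).
rewrite E (_ : (fun _ => _) = (fun k => \int[mu]_x (dens (U_ k) x * h x)%:E)%E); last first.
  by apply/funext => k; rewrite E.
exact: (setwise_weak_cvg (fun k => is_density_radial (U_ k)) (is_density_radial U) H mh hM).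
Qed.

Lemma weak_cvg_density_mass (U_ : nat -> state) (U : state) (A : set R) :
  weak_cvg_density n (fun k => profile (U_ k)) (profile U) -> measurable A ->
  mass (dens (U_ k)) A @[k --> \oo] --> mass (dens U) A.
Proof.
move=> H mA; have E (V : state) : (\int[mu]_(x in `]0%R, +oo[) (profile V x * \1_A x * P x)%:E =
    (mass (dens V) A)%:E)%E.
  by rewrite radial_integralE density_integral_indic//; exact: is_density_radial.
have : essentially_bounded (\1_A : R -> R).
  split; first by apply: measurable_funTS; exact: measurable_indic.
  by exists 1; apply: aeW => x _; rewrite indicE; case: (_ \in _); rewrite ?normr1 ?normr0.
move=> /H; rewrite E => /fine_cvgP[_]; apply: cvg_trans.
by apply: near_eq_cvg; near=> k; rewrite /= E.
Unshelve. all: by end_near. Qed.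

Lemma weak_compactness (C : R) (U_ : nat -> state) :
  (forall k, (Phi f (U_ k) <= C%:E)%E) ->
  cvgn (fun k => ball_radius (U_ k)) ->
  (forall x, cvgn (fun k => Defs.cdf n (profile (U_ k)) x)) ->
  exists U : state, weak_cvg U_ U.
Proof.
move=> UC cr ccdf; have [R0 R00 HR] := ball_radius_bounded C.
have hw k := is_density_radial (U_ k).
have UI e : 0 < e -> exists2 d, 0 < d & forall A, measurable A ->
    (mu (A `&` `]0%R, R0]) < d%:E)%E -> forall k, mass (dens (U_ k)) A <= e.
  move=> e0; have [d d0 Hd] := mass_unif_integrable HR R00 e0; exists d => //.
  by move=> A mA Ad k; exact: Hd.
have muR : (mu `]0%R, R0] < +oo)%E.
  by rewrite lebesgue_measure_itv/=; case: ifPn => _; rewrite ltry.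
have tail x : cvgn (fun k => mass (dens (U_ k)) `]x, +oo[%classic).
  rewrite (_ : (fun _ => _) = (fun k => 1 - Defs.cdf n (profile (U_ k)) x)).
    by apply: is_cvgB; [exact: is_cvg_cst|exact: ccdf].
  by apply/funext => k; rewrite cdfE opprB addrCA subrr addr0.
have [v hv wv] := setwise_limit_density hw (measurable_itv _) muR UI tail.
have [mv v0 v1] := hv.
set r := limn (fun k => ball_radius (U_ k)).
have r0 : 0 <= r by apply: limr_ge => //; near=> k; exact: ball_radius_ge0.
have vneg : mass v `]-oo, 0] = 0.
  have := wv _ (measurable_itv `]-oo, 0]).
  rewrite (_ : (fun _ => _) = cst 0); last by apply/funext => k; rewrite mass_radial_npos.
  by move=> /(cvg_lim (@Rhausdorff R)); rewrite lim_cst.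
have vpos (A : set R) : measurable A -> mass v (A `&` `]0, +oo[) = mass v A.
  move=> mA; have mA' : measurable (A `&` `](0:R), +oo[) by exact: measurableI.
  have mA'' : measurable (A `\` `](0:R), +oo[) by exact: measurableD.
  rewrite -[in RHS](setUIDK A `]0, +oo[) massU//; last first.
    by apply/disj_set2P; apply/seteqP; split => x // [[_ ?]] [].
  rewrite [X in _ + X](_ : _ = 0) ?addr0//.
  apply/eqP; rewrite eq_le mass_ge0// andbT -[leRHS]vneg; apply: le_mass => //.
  by move=> x [_ /=]; rewrite !in_itv/= andbT => /negP; rewrite -leNgt.
(* Eventually the radii are below r + d/2, so all the mass beyond [r] lies in an interval of length
   d/2, and uniform integrability makes it at most [e]. *)
have vr : mass v `]r, +oo[ = 0.
  apply/eqP; rewrite eq_le mass_ge0// andbT; apply/ler_addgt0Pr => e e0; rewrite add0r.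
  have [d d0 Hd] := UI _ e0.
  have d20 : 0 < d / 2 by rewrite divr_gt0.
  rewrite -(cvg_lim (@Rhausdorff R) (wv _ (measurable_itv `]r, +oo[))).
  apply: limr_le; first exact: cvgP (wv _ (measurable_itv _)).
  have /cvgrPdist_lt/(_ _ d20) := cr; apply: filterS => k.
  rewrite -/r ltr_norml => /andP[H _].
  have -> : `]r, +oo[%classic = `]r, r + d / 2] `|` `]r + d / 2, +oo[.
    by rewrite -itv_bndbnd_setU//= bnd_simp lerDl ltW.
  rewrite massU//; last first.
    apply/disj_set2P/seteqP; split => // x [] /=; rewrite !in_itv/= andbT => /andP[_].
    by move=> /le_lt_trans/[apply]; rewrite ltxx.
  rewrite mass_radial_tail ?addr0; last lra.
  apply: Hd => //; apply: (@le_lt_trans _ _ (mu `]r, r + d / 2])).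
    by apply: le_measure; rewrite ?inE//; exact: measurableI.
  rewrite lebesgue_measure_itv/= lte_fin ltrDl d20 -EFinD lte_fin addrAC subrr add0r.
  by rewrite ltr_pdivrMr// ltr_pMr// ltr1n.
pose u x := v x / P x.
have uP x : 0 < x -> u x * P x = v x.
  by move=> x0; rewrite /u divfK// gt_eqF// /perim mulr_gt0// exprn_gt0.
have iuP (A : set R) : measurable A -> A `<=` `]0, +oo[ ->
    (\int[mu]_(x in A) (u x * P x)%:E = (mass v A)%:E)%E.
  move=> mA A0; rewrite massE//; apply: eq_integral => x; rewrite inE => /A0/=.
  by rewrite in_itv/= andbT => x0; rewrite uP.
have hu : radial_density n u.
  split.
  - apply: measurable_funM; first exact: measurable_funTS.
    apply: open_continuous_measurable_fun; first exact: interval_open.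
    move=> x; rewrite inE/= in_itv/= andbT => x0.
    by apply: cvgV; [rewrite gt_eqF// /perim mulr_gt0// exprn_gt0|exact: continuous_perim].
  - by move=> x x0; rewrite divr_ge0// perim_ge0// ltW.
  - by rewrite iuP// -[X in mass v X]setTI vpos// massT.
have usupp : (\int[mu]_(x in `]r, +oo[) (u x * P x)%:E = 0)%E.
  rewrite iuP// ?vr// => x /=; rewrite !in_itv/= !andbT; exact: le_lt_trans.
exists (State r0 hu usupp); split => /=; first exact: cr.
apply: (@weak_cvg_density_setwise U_ (State r0 hu usupp)) => A mA.
suff -> : mass (radial_mass_density n u) A = mass v A by exact: wv.
rewrite -vpos// /mass; congr fine; rewrite integral_mkcondr; apply: eq_integral => x _.
rewrite /radial_mass_density !patchE; case: ifPn => //.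
by rewrite inE/= in_itv/= andbT => x0; rewrite uP.
Unshelve. all: by end_near. Qed.

End Compactness.

(** * Lower semicontinuity of the energy *)

Section LowerSemicontinuity.
Context {R : realType} (n : nat) (f : R -> R).
Hypotheses (n_gt1 : (1 < n)%N) (hf : admissible_energy n f).
Hypothesis omega_pos : 0 < n%:R * @omega R n.
Local Notation mu := (@lebesgue_measure R).
Local Notation P := (@perim R n).
Local Notation f' := (derive1 f).
Local Notation state := (state (R := R) n).

Lemma le_integral_measurable (D : set R) (g h : R -> \bar R) : measurable D ->
  measurable_fun D g -> measurable_fun D h -> (forall x, D x -> (g x <= h x)%E) ->
  (\int[mu]_(x in D) g x <= \int[mu]_(x in D) h x)%E.
Proof.
move=> mD mg mh gh; rewrite integralE [leRHS]integralE; apply: leeB.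
  apply: ge0_le_integral => //; [exact: measurable_funepos..|].
  by move=> x Dx; rewrite !funeposE le_max2// gh.
apply: ge0_le_integral => //; [exact: measurable_funeneg..|].
by move=> x Dx; rewrite !funenegE le_max2// leeN2 gh.
Qed.

Lemma limn_einf_le_near (v : (\bar R)^nat) (c : \bar R) :
  (\forall k \near \oo, (v k <= c)%E) -> (limn_einf v <= c)%E.
Proof.
move=> [N _ HN]; rewrite limn_einf_lim; apply: lime_le; first exact: is_cvg_einfs.
near=> k; apply: le_trans (HN (maxn k N) (leq_maxr _ _)).
by apply: ereal_inf_lbound; exists (maxn k N) => //=; exact: leq_maxl.
Unshelve. all: by end_near. Qed.

(** The tangent at [a], evaluated at 0 and at 2a, squeezes a f'(a) between f(a) and f(2a) - f(a).
    The derivative itself may be unbounded near 0. *)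
Lemma energy_derive_small (e : R) : 0 < e ->
  exists2 d : R, 0 < d & forall a, 0 < a -> a < d -> `|f a| <= e /\ a * `|f' a| <= e.
Proof.
move=> e0; have e20 : 0 < e / 2 by rewrite divr_gt0.
have /cvgr0Pnorm_le /(_ _ e20) [d /= d0 Hd] := energy_cvg0 hf.
have H y : 0 < y -> y < d -> `|f y| <= e / 2.
  by move=> y0 yd; apply: Hd => //=; rewrite sub0r normrN gtr0_norm.
exists (d / 2); first by rewrite divr_gt0.
move=> a a0 ad; have fa : `|f a| <= e / 2 by apply: H => //; lra.
have f2a : `|f (2 * a)| <= e / 2 by apply: H => //; lra.
split; first lra.
have T0 := energy_tangent hf a0 (lexx 0).
have T2 : f a + f' a * (2 * a - a) <= f (2 * a) by apply: (energy_tangent hf) => //; lra.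
rewrite (energy0 hf) in T0.
rewrite -{1}(gtr0_norm a0) -normrM; move: fa f2a.
rewrite !ler_norml => /andP[? ?] /andP[? ?]; apply/andP; split; lra.
Qed.

Lemma energy_derive_mono (a b : R) : 0 < a -> a <= b -> f' a <= f' b.
Proof.
move=> a0; rewrite le_eqVlt => /orP[/eqP -> //|ab].
have b0 := lt_trans a0 ab.
have := energy_tangent hf a0 (ltW b0); have := energy_tangent hf b0 (ltW a0).
move=> H1 H2; have : (f' a - f' b) * (b - a) <= 0 by lra.
by rewrite pmulr_lle0 ?subr_gt0// subr_le0.
Qed.

(** Far out f(y) >= f(1), and the tangent at [y] evaluated at 1 gives the sign. It makes truncation
    from above harmless in the tangent inequality. *)
Lemma energy_derive_ge0 : exists2 b : R, 1 < b & forall y, b <= y -> 0 <= f' y.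
Proof.
have [M M0 HM] := energy_superlinear_ge hf (Num.max 0 (f 1)).
exists (Num.max 2 M); first by rewrite lt_max ltr1n.
move=> y; rewrite ge_max => /andP[y2 My].
have y0 : 0 < y by lra.
have := energy_tangent hf y0 ler01; have := HM _ My.
have : f 1 <= Num.max 0 (f 1) * y.
  apply: (@le_trans _ _ (Num.max 0 (f 1))); first by rewrite le_max lexx orbT.
  by rewrite ler_peMr ?le_max ?lexx//; lra.
move=> H1 H2 H3; have : 0 <= f' y * (y - 1) by lra.
by rewrite pmulr_lge0//; lra.
Qed.

Let clamp (a b x : R) := Num.max a (Num.min b x).

Let clampP (a b x : R) : a <= b -> a <= clamp a b x <= b.
Proof. by move=> ab; rewrite le_max lexx/= ge_max ab ge_min lexx. Qed.

Lemma measurable_clamp (a b : R) (D : set R) (g : R -> R) : measurable_fun D g ->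
  measurable_fun D (fun x => clamp a b (g x)).
Proof.
move=> mg; apply: measurable_maxr; first exact: measurable_cst.
by apply: measurable_minr => //; exact: measurable_cst.
Qed.

(** * Tangent inequality at a truncated limit profile *)

Section ClampedEnergy.
Variables (U_ : nat -> state) (U : state) (C s a b : R).
Hypotheses (UU : weak_cvg U_ U) (UC : \forall k \near \oo, (Phi f (U_ k) <= C%:E)%E).
Hypothesis Us : \forall k \near \oo, ball_radius (U_ k) <= s.
Hypotheses (a0 : 0 < a) (ab : a <= b) (fb : 0 <= f' b).

Local Notation u := (profile U).
Let y x := clamp a b (u x).
Let yP x : a <= y x <= b. Proof. exact: clampP. Qed.
Let y0 x : 0 < y x. Proof. by case/andP: (yP x) => /(lt_le_trans a0). Qed.
Let D0 : `]0, s] `<=` `](0:R), +oo[.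
Proof. by move=> x /=; rewrite !in_itv/= andbT => /andP[]. Qed.

(** Truncation keeps [y] in a compact subset of ]0, +oo[, so f'(y) is bounded and is an admissible
    test function. The tangent inequality f(u_k) >= h + u_k f'(y) is affine in u_k and passes to the
    weak limit; replacing the limit u by y again costs at most a |f'(a)| pointwise. *)
Lemma clamped_energy_le (I : R) : (\int[mu]_(x in `]0%R, s]) (P x)%:E = I%:E)%E ->
  (\int[mu]_(x in `]0%R, s]) (f (y x) * P x)%:E <=
   (C - P (ball_radius U) + a * `|f' a| * I)%:E)%E.
Proof.
move=> IE; have [mu_ u0 _] := profileP U.
have [m m0 Hm] := energy_lbound hf.
have mus : measurable_fun `]0, s] u by exact: measurable_funS mu_.
have my : measurable_fun `]0, s] y by exact: measurable_clamp.
have mf'y : measurable_fun `]0, s] (fun x => f' (y x)).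
  apply: (@measurableT_comp _ _ _ _ _ _ (fun z : R => f' (clamp a b z))) => //.
  by apply: continuous_measurable_fun; exact: continuous_derive_clamp hf _ _ a0 ab.
have mfy : measurable_fun `]0, s] (fun x => f (y x)).
  apply: (eq_measurable_fun (fun x => f (Num.max 0 (y x)))).
    by move=> x _; rewrite max_r// ltW.
  apply: (@measurableT_comp _ _ _ _ _ _ (fun z : R => f (Num.max 0 z))) => //.
  by apply: continuous_measurable_fun; exact: continuous_energy_max0 hf.
pose B := `|f' a| + `|f' b|.
have B0 : 0 <= B by rewrite addr_ge0.
have f'yB x : `|f' (y x)| <= B.
  have /andP[ay yb] := yP x.
  have := energy_derive_mono a0 ay; have := energy_derive_mono (y0 x) yb.
  rewrite /B ler_norml; have := ler_norm (f' b); have := ler_norm (- f' a); rewrite normrN.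
  have := normr_ge0 (f' a); have := normr_ge0 (f' b).
  by move=> *; apply/andP; split; lra.
pose h x := f (y x) - f' (y x) * y x.
have mh : measurable_fun `]0, s] h.
  by apply: measurable_funB => //; exact: measurable_funM.
have hB x : `|h x| <= m + B * b.
  have /andP[ay yb] := yP x.
  have T0 := energy_tangent hf (y0 x) (lexx 0); rewrite (energy0 hf) in T0.
  have fm := Hm _ (ltW (y0 x)).
  have : f' (y x) * y x <= B * b.
    apply: (@le_trans _ _ (`|f' (y x)| * y x)).
      by rewrite ler_wpM2r ?ler_norm// ltW.
    by apply: ler_pM => //; exact: ltW.
  have : 0 <= B * b by rewrite mulr_ge0// (le_trans (ltW a0)).
  by rewrite ler_norml /h => *; apply/andP; split; lra.
pose g := (fun x => f' (y x)) \_ `](0:R), s].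
have mg : measurable_fun setT g by apply/(measurable_restrictT _ _).1.
have gB x : `|g x| <= B by rewrite /g patchE; case: ifPn => // _; rewrite normr0.
have eg : essentially_bounded g.
  split; first exact: measurable_funTS.
  by exists B; apply: aeW => x _.
have ihP : mu.-integrable `]0, s] (fun x => (h x * P x)%:E).
  apply: (@le_integrable _ _ R mu _ _ _ (fun x => ((m + B * b) * P x)%:E)) => //.
  - apply/measurable_EFinP; apply: measurable_funM => //; exact: measurable_perim.
  - move=> x /D0/=; rewrite in_itv/= andbT => x0; rewrite lee_fin !normrM.
    by rewrite ler_wpM2r// (le_trans (hB x))// ler_norm.
  - by apply: integrable_scale => //; exact: integrable_perim.
have gE (V : state) : (\int[mu]_(x in `]0%R, +oo[) (profile V x * g x * P x)%:E =
    \int[mu]_(x in `]0%R, s]) (profile V x * f' (y x) * P x)%:E)%E.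
  rewrite integral_mkcond [RHS]integral_mkcond; apply: eq_integral => x _.
  rewrite /g !patchE; case: ifPn => x0; case: ifPn => xs//.
  - by rewrite mulr0 mul0r.
  - by move: xs x0; rewrite inE notin_setE => /D0.
have iug (V : state) : mu.-integrable `]0, s] (fun x => (profile V x * f' (y x) * P x)%:E).
  have [mv v0 _] := profileP V.
  apply: (@le_integrable _ _ R mu _ _ _
    (fun x => (B * radial_mass_density n (profile V) x)%:E)) => //.
  - apply/measurable_EFinP; apply: measurable_funM; last exact: measurable_perim.
    apply: measurable_funM => //; exact: measurable_funS mv.
  - move=> x /D0 xD; have := xD; rewrite /= in_itv/= andbT => x0.
    rewrite lee_fin /radial_mass_density patchE mem_set// mulrAC mulrC.
    by rewrite normrM [leRHS]normrM ler_wpM2r// (le_trans (f'yB x))// ler_norm.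
  - apply: integrable_scale => //.
    apply: (@integrableS _ _ _ _ setT) => //.
    by apply: integrable_density; exact: is_density_radial.
pose S (V : state) := fine (\int[mu]_(x in `]0%R, s]) (profile V x * f' (y x) * P x)%:E)%E.
have SE V : ((S V)%:E = \int[mu]_(x in `]0%R, s]) (profile V x * f' (y x) * P x)%:E)%E.
  by rewrite fineK//; exact: integrable_fin_num (iug V).
pose H := fine (\int[mu]_(x in `]0%R, s]) (h x * P x)%:E)%E.
have HE : (H%:E = \int[mu]_(x in `]0%R, s]) (h x * P x)%:E)%E.
  by rewrite fineK//; exact: integrable_fin_num ihP.
have HSE V : ((H + S V)%:E =
    \int[mu]_(x in `]0%R, s]) ((h x + profile V x * f' (y x)) * P x)%:E)%E.
  rewrite EFinD HE SE -integralD//.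
  by apply: eq_integral => x _; rewrite -EFinD -mulrDl.
have mhv V : measurable_fun `]0, s] (fun x => (h x + profile V x * f' (y x)) * P x).
  have [mv v0 _] := profileP V.
  apply: measurable_funM; last exact: measurable_perim.
  apply: measurable_funD => //; apply: measurable_funM => //; exact: measurable_funS mv.
have cS : S (U_ k) @[k --> \oo] --> S U.
  have [_ /(_ g eg)] := UU; rewrite gE -SE => /fine_cvgP[_]; apply: cvg_trans.
  by apply: near_eq_cvg; near=> k; rewrite /= gE.
have HSU : H + S U + P (ball_radius U) <= C.
  have cv : (H + S (U_ k) + P (ball_radius (U_ k))) @[k --> \oo] -->
      H + S U + P (ball_radius U).
    apply: cvgD; first by apply: cvgD => //; exact: cvg_cst.
    by apply: continuous_cvg; [exact: continuous_perim|case: UU].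
  rewrite -(cvg_lim (@Rhausdorff R) cv); apply: limr_le; first exact: cvgP cv.
  near=> k; have Ck : (Phi f (U_ k) <= C%:E)%E by near: k.
  have sk : ball_radius (U_ k) <= s by near: k.
  rewrite -lee_fin; apply: le_trans Ck; rewrite /Phi addrC EFinD leeD2l//.
  rewrite (internal_energy_restrict hf sk) HSE; have [mv v0 _] := profileP (U_ k).
  apply: le_integral_measurable => //.
  - exact/measurable_EFinP.
  - apply/measurable_EFinP; apply: measurable_funM; last exact: measurable_perim.
    exact: measurable_energy_profile.
  - move=> x /D0/=; rewrite in_itv/= andbT => x0.
    rewrite lee_fin ler_wpM2r ?perim_ge0 ?(ltW x0)//.
    by have := energy_tangent hf (y0 x) (v0 _ x0); rewrite /h; lra.
have iP := integrable_perim n s.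
apply: (@le_trans _ _ (\int[mu]_(x in `]0%R, s])
    ((h x + u x * f' (y x)) * P x + a * `|f' a| * P x)%:E)%E).
  apply: le_integral_measurable => //.
  - apply/measurable_EFinP; apply: measurable_funM => //; exact: measurable_perim.
  - apply/measurable_EFinP; apply: measurable_funD; first exact: mhv.
    by apply: measurable_funM; [exact: measurable_cst|exact: measurable_perim].
  - move=> x /D0/=; rewrite in_itv/= andbT => x0.
    rewrite lee_fin -mulrDl ler_wpM2r ?perim_ge0 ?(ltW x0)//.
    (* Above [b] the product is nonnegative since f'(b) >= 0, between the two levels it is zero, and
       below [a] its absolute value is at most a |f'(a)|. *)
    suff : 0 <= f' (y x) * (u x - y x) + a * `|f' a| by rewrite /h; lra.
    have := u0 _ x0; rewrite /y /clamp; set z := u x => z0.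
    have af0 : 0 <= a * `|f' a| by rewrite mulr_ge0// ltW.
    case: (leP b z) => bz.
      by rewrite max_r// addr_ge0// mulr_ge0// subr_ge0.
    case: (leP a z) => az; first by rewrite subrr mulr0 add0r.
    have : `|f' a * (z - a)| <= a * `|f' a|.
      by rewrite normrM mulrC ler_wpM2r// ler_norml; apply/andP; split; lra.
    by rewrite ler_norml => /andP[+ _]; lra.
under eq_integral do rewrite EFinD.
rewrite integralD//; last 2 first.
- rewrite [X in mu.-integrable _ X](_ : _ =
    (fun x => (h x * P x)%:E) \+ (fun x => (u x * f' (y x) * P x)%:E))%E.
    exact: integrableD.
  by apply/funext => x; rewrite -EFinD -mulrDl.
- exact: integrable_scale.
rewrite -HSE [X in (_ + X <= _)%E]integral_scale// IE -EFinM -EFinD lee_fin.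
by rewrite lerD2r; lra.
Unshelve. all: by end_near. Qed.

End ClampedEnergy.

(** Lower semicontinuity as closedness of sublevels. The truncation is removed by Fatou's lemma,
    applied after adding [m] to make the integrands nonnegative. *)
Lemma Phi_lsc (U_ : nat -> state) (U : state) (C : R) : weak_cvg U_ U ->
  (\forall k \near \oo, (Phi f (U_ k) <= C%:E)%E) -> (Phi f U <= C%:E)%E.
Proof.
move=> UU UC; have [s s0 Hs] := ball_radius_bounded n_gt1 hf omega_pos C.
have Us : \forall k \near \oo, ball_radius (U_ k) <= s.
  by apply: filterS UC => k /Hs.
have rs : ball_radius U <= s.
  have [cr _] := UU; rewrite -(cvg_lim (@Rhausdorff R) cr).
  by apply: limr_le => //; exact: cvgP cr.
have [mu_ u0 _] := profileP U.
have [m m0 Hm] := energy_lbound hf.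
have iP := integrable_perim n s.
pose I := fine (\int[mu]_(x in `]0%R, s]) (P x)%:E)%E.
have IE : (\int[mu]_(x in `]0%R, s]) (P x)%:E = I%:E)%E.
  by rewrite fineK//; exact: integrable_fin_num iP.
have I0 : 0 <= I.
  rewrite -lee_fin -IE; apply: integral_ge0 => x /=; rewrite in_itv/= => /andP[x0 _].
  by rewrite lee_fin perim_ge0// ltW.
have D0 : `]0, s] `<=` `](0:R), +oo[.
  by move=> x /=; rewrite !in_itv/= andbT => /andP[].
have [b0 b01 Hb] := energy_derive_ge0.
pose a (j : nat) : R := j.+1%:R^-1.
have a0 j : 0 < a j by rewrite invr_gt0.
(* Starting from [b0] keeps the derivative at the upper level nonnegative, and b0 > 1 >= a_j keeps
   the levels ordered. *)
pose b (j : nat) := b0 + j%:R.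
have ab j : a j <= b j.
  rewrite (@le_trans _ _ 1)//; first by rewrite invf_le1// ler1n.
  by rewrite /b ler_wpDr// ltW.
have fb j : 0 <= f' (b j) by apply: Hb; rewrite lerDl.
pose y j x := clamp (a j) (b j) (profile U x).
have y0 j x : 0 < y j x by rewrite /y /clamp lt_max a0.
have CE j := clamped_energy_le UU UC Us (a0 j) (ab j) (fb j) IE.
have cvga : a j @[j --> \oo] --> 0 by exact: cvg_harmonic.
have mfy j : measurable_fun `]0, s] (fun x => f (y j x)).
  apply: (eq_measurable_fun (fun x => f (Num.max 0 (y j x)))).
    by move=> x _; rewrite max_r// ltW.
  apply: (@measurableT_comp _ _ _ _ _ _ (fun z : R => f (Num.max 0 z))) => //.
    by apply: continuous_measurable_fun; exact: continuous_energy_max0 hf.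
  by apply: measurable_clamp; exact: measurable_funS mu_.
have cvgy x : 0 < x -> f (y j x) @[j --> \oo] --> f (profile U x).
  move=> x0; have := u0 _ x0; rewrite le_eqVlt => /orP[/eqP ux|ux].
    rewrite -ux (energy0 hf); apply/cvgr0Pnorm_le => e e0.
    have [d d0 Hd] := energy_derive_small e0.
    have /cvgr0Pnorm_lt/(_ _ d0) := cvga; apply: filterS => j.
    rewrite gtr0_norm// => ad; have [+ _] := Hd _ (a0 j) ad.
    rewrite /y -ux /clamp min_r ?max_l//; first exact: ltW.
    by rewrite /b addr_ge0//; lra.
  have /cvgrPdist_lt/(_ _ ux) := cvga => Ha.
  have Hbx : \forall j \near \oo, profile U x <= b j.
    have := nbhs_infty_ger (profile U x); apply: filterS => j uj.
    by rewrite /b (le_trans uj)// lerDr; lra.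
  apply: cvg_near_cst; near=> j.
  have aj : a j <= profile U x.
    suff : `|0 - a j| < profile U x by rewrite sub0r normrN gtr0_norm// => /ltW.
    by near: j.
  have bj : profile U x <= b j by near: j.
  by rewrite /y /clamp min_r// max_r.
pose F j x := ((f (y j x) + m) * P x)%:E.
have mF j : measurable_fun `]0, s] (F j).
  apply/measurable_EFinP; apply: measurable_funM; last exact: measurable_perim.
  by apply: measurable_funD => //; exact: measurable_cst.
have F0 j x : `]0, s]%classic x -> (0 <= F j x)%E.
  move=> /D0/=; rewrite in_itv/= andbT => x0.
  by rewrite lee_fin mulr_ge0 ?perim_ge0 ?(ltW x0)// -lerBlDr sub0r Hm// ltW.
have := fatou mu (measurable_itv _) mF F0.
have -> : (\int[mu]_(x in `]0%R, s]) limn_einf (F ^~ x) =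
    \int[mu]_(x in `]0%R, s]) ((f (profile U x) + m) * P x)%:E)%E.
  apply: eq_integral => x; rewrite inE => /D0/=; rewrite in_itv/= andbT => x0.
  have cv : (F ^~ x) @ \oo --> ((f (profile U x) + m) * P x)%:E.
    apply: cvg_EFin; first by near=> j.
    apply: cvgMl; apply: cvgD; [exact: cvgy|exact: cvg_cst].
  by rewrite is_cvg_limn_einfE ?(cvg_lim (@ereal_hausdorff R) cv)//; exact: cvgP cv.
have Hm' z : 0 <= z -> - (m + 0 * z) <= f z by move=> z0; rewrite mul0r addr0; exact: Hm.
have := internal_energy_add hf m0 (lexx 0) Hm' rs.
under [X in _ = X -> _]eq_integral do rewrite mul0r addr0.
move=> <-; rewrite IE adde0 -EFinM => Hle.
suff HC : (internal_energy n f (profile U) + (m * I)%:E <=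
    (C - P (ball_radius U) + m * I)%:E)%E.
  rewrite /Phi; move: HC; case: (internal_energy _ _ _) => [z| |]//.
    by rewrite -!EFinD !lee_fin; lra.
  by move=> _; rewrite addeNy leNye.
apply: le_trans Hle _; apply/lee_addgt0Pr => e e0.
have e'0 : 0 < e / (I + 1) by rewrite divr_gt0// ltr_wpDl.
have [d d0 Hd] := energy_derive_small e'0.
apply: limn_einf_le_near.
have /cvgr0Pnorm_lt/(_ _ d0) := cvga; apply: filterS => j.
rewrite gtr0_norm// => ad; have [_ Ha] := Hd _ (a0 j) ad.
have -> : (\int[mu]_(x in `]0%R, s]) F j x =
    \int[mu]_(x in `]0%R, s]) (f (y j x) * P x)%:E + (m * I)%:E)%E.
  rewrite EFinM -IE -integral_scale// -integral_add_bounded_below//.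
  - by apply: eq_integral => x _; rewrite /F mulrDl.
  - by apply: measurable_funM => //; exact: measurable_perim.
  - exact: integrable_scale.
  - move=> x /D0/=; rewrite in_itv/= andbT => x0.
    by rewrite mulr_ge0 ?perim_ge0 ?(ltW x0).
  - by move=> x /(F0 j); rewrite lee_fin mulrDl.
apply: (le_trans (leeD2r _ (CE j))); rewrite -!EFinD lee_fin.
have : a j * `|f' (a j)| * I <= e / (I + 1) * (I + 1).
  by apply: ler_pM => //; [rewrite mulr_ge0// ltW|rewrite lerDl].
by rewrite divfK ?gt_eqF ?ltr_wpDl//; lra.
Unshelve. all: by end_near. Qed.

End LowerSemicontinuity.

(** * Quantiles and the metric *)

Section Metric.
Context {R : realType} (n : nat).
Local Notation mu := (@lebesgue_measure R).
Local Notation P := (@perim R n).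
Local Notation state := (state (R := R) n).
Local Notation dens U := (radial_mass_density n (profile U)).
Local Notation F U := (Defs.cdf n (profile U)).
Local Notation q U := (quantile n (profile U)).

Section Quantile.
Variable U : state.

Lemma le_cdf (x y : R) : x <= y -> F U x <= F U y.
Proof.
move=> xy; rewrite !cdfE lerD2l lerN2; apply: le_mass => //.
  exact: is_density_radial.
by move=> z /=; rewrite !in_itv/= !andbT; exact: le_lt_trans.
Qed.

Lemma cdf_npos (x : R) : x <= 0 -> F U x = 0.
Proof.
by move=> x0; rewrite /Defs.cdf set_itv_ge ?Rintegral_set0// bnd_simp -leNgt.
Qed.

Lemma cdf_ge_radius (x : R) : ball_radius U <= x -> F U x = 1.
Proof. by move=> rx; rewrite cdfE mass_radial_tail// subr0. Qed.

Lemma cdf_ge0 (x : R) : 0 <= F U x.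
Proof. by rewrite cdfE subr_ge0 mass_le1//; exact: is_density_radial. Qed.

Lemma cdf_le1 (x : R) : F U x <= 1.
Proof. by rewrite cdfE gerBl mass_ge0//; exact: is_density_radial. Qed.

Let quantile_set (s : R) := [set x : R | 0 <= x /\ F U x <= s].

Let quantile_set_lt (s x : R) : s < 1 -> quantile_set s x -> x < ball_radius U.
Proof.
move=> s1 [x0 Fx]; rewrite ltNge; apply/negP => /cdf_ge_radius Fx1.
by move: Fx; rewrite Fx1 leNgt s1.
Qed.

Let has_sup_quantile_set (s : R) : 0 <= s -> s < 1 -> has_sup (quantile_set s).
Proof.
move=> s0 s1; split; first by exists 0; split => //; rewrite cdf_npos.
by exists (ball_radius U) => x /(quantile_set_lt s1)/ltW.
Qed.

(** Together with [quantile_le] this expresses that the quantile is a generalized inverse of the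
    distribution function; estimates on quantiles go through these two implications. The level must
    stay below 1 for the supremum to be over a bounded set. *)
Lemma quantile_ge (s x : R) : 0 <= s -> s < 1 -> 0 <= x -> F U x <= s -> x <= q U s.
Proof.
by move=> s0 s1 x0 Fx; apply: sup_upper_bound => //; exact: has_sup_quantile_set.
Qed.

Lemma quantile_le (s x : R) : 0 <= s -> s < F U x -> q U s <= x.
Proof.
move=> s0 Fx; have s1 : s < 1 by apply: lt_le_trans Fx (cdf_le1 x).
apply: ge_sup; first by case: (has_sup_quantile_set s0 s1).
move=> y [y0 Fy]; rewrite leNgt; apply/negP => /ltW/le_cdf.
by move=> /le_trans/(_ Fy); rewrite leNgt Fx.
Qed.

Lemma quantile_bounded (s : R) : 0 <= s -> s < 1 -> 0 <= q U s <= ball_radius U.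
Proof.
move=> s0 s1; rewrite quantile_ge ?cdf_npos//=.
by apply: quantile_le => //; rewrite cdf_ge_radius.
Qed.

Lemma quantile_nondecreasing (s t : R) : 0 <= s -> s <= t -> t < 1 -> q U s <= q U t.
Proof.
move=> s0 st t1; have s1 := le_lt_trans st t1.
apply: ge_sup; first by case: (has_sup_quantile_set s0 s1).
move=> y [y0 Fy]; apply: quantile_ge => //; first exact: le_trans st.
exact: le_trans st.
Qed.

(** By monotonicity the preimage of a ray is an interval. *)
Lemma measurable_quantile : measurable_fun (`]0, 1[ : set R) (q U).
Proof.
apply: (measurability (@RGenOInfty.G R)) => [|/= _ [_] [a] -> <-].
  exact: RGenOInfty.measurableE.
apply: is_interval_measurable => s t /=.
rewrite !in_itv/= !andbT => -[/andP[s0 s1] qs] [/andP[t0 t1] qt] u /andP[su ut].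
have u0 : 0 < u by exact: lt_le_trans su.
have u1 : u < 1 by exact: le_lt_trans t1.
rewrite !in_itv/= andbT u0 u1; split => //; apply: lt_le_trans qs _.
by apply: quantile_nondecreasing => //; exact: ltW.
Qed.

End Quantile.

Definition W2_sqr (U V : state) : R :=
  \int[mu]_(s in `]0, 1[) (`|q U s - q V s| ^+ 2).

(** The 1-Wasserstein distance of the radial laws; its triangle inequality follows pointwise under
    the integral. *)
Definition W1 (U V : state) : R := \int[mu]_(s in `]0, 1[) `|q U s - q V s|.

Lemma integrable_add (D : set R) (g h : R -> R) : measurable D ->
  mu.-integrable D (EFin \o g) -> mu.-integrable D (EFin \o h) ->
  mu.-integrable D (EFin \o (fun x => g x + h x)).
Proof.
move=> mD ig ih; rewrite (_ : EFin \o _ = (EFin \o g) \+ (EFin \o h))%E.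
  exact: integrableD.
by apply/funext.
Qed.

Lemma mu_unit_itv : mu `](0:R), 1[ = 1%E.
Proof. by rewrite lebesgue_measure_itv/= lte_fin ltr01 oppr0 adde0. Qed.

Lemma integrable_unit_itv (g : R -> R) (M : R) : measurable_fun (`]0, 1[ : set R) g ->
  (forall s, 0 < s -> s < 1 -> `|g s| <= M) -> mu.-integrable `]0, 1[ (EFin \o g).
Proof.
move=> mg gM; apply: measurable_bounded_integrable => //.
  by rewrite /= mu_unit_itv ltry.
exists M; split; first by rewrite num_real.
by move=> x Mx s /=; rewrite in_itv/= => /andP[s0 s1]; rewrite (le_trans (gM _ s0 s1))// ltW.
Qed.

Let measurable_qdiff (U V : state) : measurable_fun (`]0, 1[ : set R) (fun s => `|q U s - q V s|).
Proof.
apply: measurableT_comp => //.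
by apply: measurable_funB; exact: measurable_quantile.
Qed.

Lemma quantile_diff_le (U V : state) (M s : R) : ball_radius U <= M -> ball_radius V <= M ->
  0 < s -> s < 1 -> `|q U s - q V s| <= M.
Proof.
move=> UM VM s0 s1.
have /andP[? ?] := quantile_bounded U (ltW s0) s1.
have /andP[? ?] := quantile_bounded V (ltW s0) s1.
by rewrite ler_norml; apply/andP; split; lra.
Qed.

Let bnd (U V : state) := Num.max (ball_radius U) (ball_radius V).

Let qdiff_bnd (U V : state) (s : R) : 0 < s -> s < 1 -> `|q U s - q V s| <= bnd U V.
Proof. by apply: quantile_diff_le; rewrite le_max lexx ?orbT. Qed.

Lemma integrable_qdiff (U V : state) :
  mu.-integrable `]0, 1[ (EFin \o (fun s => `|q U s - q V s|)).
Proof.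
apply: (@integrable_unit_itv _ (bnd U V)); first exact: measurable_qdiff.
by move=> s s0 s1; rewrite normr_id qdiff_bnd.
Qed.

Lemma integrable_qdiff_sqr (U V : state) :
  mu.-integrable `]0, 1[ (EFin \o (fun s => `|q U s - q V s| ^+ 2)).
Proof.
apply: (@integrable_unit_itv _ (bnd U V ^+ 2)).
  by apply: measurable_funX; exact: measurable_qdiff.
move=> s s0 s1; rewrite normrX normr_id lerXn2r ?nnegrE ?qdiff_bnd//.
exact: le_trans (qdiff_bnd U V s0 s1).
Qed.

Lemma W2_sqr_ge0 (U V : state) : 0 <= W2_sqr U V.
Proof. by apply: Rintegral_ge0 => s _; rewrite sqr_ge0. Qed.

Lemma poweR_half_sqr (x : \bar R) : (0 <= x)%E -> ((x `^ 2^-1) ^+ 2 = x)%E.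
Proof.
by move=> x0; rewrite poweR12_sqrt// sqr_sqrte.
Qed.

Lemma W2_sqrE (U V : state) : (W2 n (profile U) (profile V) ^+ 2 = (W2_sqr U V)%:E)%E.
Proof.
rewrite /W2 poweR_half_sqr; last by apply: integral_ge0 => s _; rewrite lee_fin sqr_ge0.
rewrite /W2_sqr /Rintegral fineK//; exact: integrable_fin_num (integrable_qdiff_sqr U V).
Qed.

Definition state_dist_sqr (kappa : R) (U V : state) : R :=
  dist_radius n (ball_radius U) (ball_radius V) ^+ 2 + W2_sqr U V / kappa.

Lemma state_dist_sqr_ge0 (kappa : R) (U V : state) : 0 < kappa -> 0 <= state_dist_sqr kappa U V.
Proof. by move=> k0; rewrite addr_ge0 ?sqr_ge0// divr_ge0 ?W2_sqr_ge0// ltW. Qed.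

Lemma state_distE (kappa : R) (U V : state) : 0 < kappa ->
  (state_dist kappa U V ^+ 2 = (state_dist_sqr kappa U V)%:E)%E.
Proof.
move=> k0; rewrite /state_dist W2_sqrE -EFinM -EFinD poweR_half_sqr//.
by rewrite lee_fin state_dist_sqr_ge0.
Qed.

Lemma W2_sqrxx (U : state) : W2_sqr U U = 0.
Proof.
rewrite /W2_sqr -[RHS](Rintegral_set0 mu (cst 0)) /Rintegral integral_set0 integral0_eq//.
by move=> s _; rewrite subrr normr0 expr0n.
Qed.

Lemma W1xx (U : state) : W1 U U = 0.
Proof. by rewrite /W1 /Rintegral integral0_eq// => s _; rewrite subrr normr0. Qed.

Lemma W1_triangle (U V W : state) : W1 U W <= W1 U V + W1 V W.
Proof.
rewrite /W1 -RintegralD//; [|exact: integrable_qdiff..].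
apply: le_Rintegral => //; first exact: integrable_qdiff.
  by apply: integrable_add => //; exact: integrable_qdiff.
by move=> s _; exact: ler_distD.
Qed.

Lemma W1C (U V : state) : W1 U V = W1 V U.
Proof. by apply: eq_Rintegral => s _; rewrite distrC. Qed.

(** Integrates x <= c + x^2/c over the unit interval, which has measure one. *)
Lemma W1_le (U V : state) (c : R) : 0 < c -> W1 U V <= c + W2_sqr U V / c.
Proof.
move=> c0; have {1}-> : c = \int[mu]_(s in `]0, 1[) (cst c s).
  by rewrite Rintegral_cst//= mu_unit_itv mulr1.
have -> : W2_sqr U V / c = \int[mu]_(s in `]0, 1[) (c^-1 * `|q U s - q V s| ^+ 2).
  by rewrite /W2_sqr mulrC -RintegralZl//; exact: integrable_qdiff_sqr.
have ic : mu.-integrable `]0, 1[ (EFin \o (cst c : R -> R)).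
  by apply: (@integrable_unit_itv _ `|c|) => //; exact: measurable_cst.
have iq : mu.-integrable `]0, 1[ (EFin \o (fun s => c^-1 * `|q U s - q V s| ^+ 2)).
  by apply: integrable_scale => //; exact: integrable_qdiff_sqr.
rewrite -RintegralD//; apply: le_Rintegral => //; first exact: integrable_qdiff.
  exact: integrable_add.
move=> s _ /=; set x := `|_|; have x0 : 0 <= x by exact: normr_ge0.
rewrite -(ler_pM2l c0) mulrDr mulrA divff ?gt_eqF// mul1r.
have := sqr_ge0 (x - c); have : 0 <= c * x by rewrite mulr_ge0// ltW.
rewrite sqrrB; lra.
Qed.

(** At each level strictly between F_U(x + d) and F_V(x) the quantile of [V] is at most x and that
    of [U] at least x + d, so each such level contributes at least [d] to [W1]. *)
Lemma cdf_le_W1 (U V : state) (x d : R) : 0 <= x -> 0 < d ->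
  F V x <= F U (x + d) + W1 U V / d.
Proof.
move=> x0 d0; have W0 : 0 <= W1 U V by apply: Rintegral_ge0 => s _.
have [FUV|FUV] := leP (F V x) (F U (x + d)).
  by apply: le_trans FUV _; rewrite lerDl divr_ge0// ltW.
rewrite -lerBlDl ler_pdivlMr//.
set a := F U (x + d) in FUV *; set b := F V x in FUV *.
have a0 : 0 <= a by exact: cdf_ge0. have b1 : b <= 1 by exact: cdf_le1.
have sub : `]a, b[ `<=` `](0:R), 1[.
  move=> s /=; rewrite !in_itv/= => /andP[sa sb].
  by rewrite (le_lt_trans a0 sa) (lt_le_trans sb b1).
have intS (g : R -> R) : mu.-integrable `]0, 1[ (EFin \o g) -> mu.-integrable `]a, b[ (EFin \o g).
  by move=> ig; apply: integrableS ig.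
have -> : (b - a) * d = \int[mu]_(s in `]a, b[) d.
  rewrite Rintegral_cst//= lebesgue_measure_itv/= lte_fin FUV.
  by rewrite mulrC.
apply: (@le_trans _ _ (\int[mu]_(s in `]a, b[) `|q U s - q V s|)).
  apply: le_Rintegral => //.
  - by apply: intS; apply: (@integrable_unit_itv _ `|d|) => //; exact: measurable_cst.
  - by apply: intS; exact: integrable_qdiff.
  - move=> s /=; rewrite in_itv/= => /andP[sa sb].
    have s0 : 0 <= s by apply: le_trans a0 (ltW sa).
    have s1 : s < 1 by exact: lt_le_trans b1.
    have qV : q V s <= x by exact: quantile_le.
    have qU : x + d <= q U s by apply: quantile_ge => //; [rewrite addr_ge0// ltW|exact: ltW].
    by apply: le_trans (ler_norm _); lra.
rewrite /W1 /Rintegral fine_le//.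
- exact: integrable_fin_num (intS _ (integrable_qdiff U V)).
- exact: integrable_fin_num (integrable_qdiff U V).
- apply: ge0_subset_integral => //; apply/measurable_EFinP; exact: measurable_qdiff.
Qed.

Section Continuity.
Variables (U_ : nat -> state) (U : state).
Hypothesis UU : weak_cvg U_ U.

Lemma cvg_cdf (x : R) : F (U_ k) x @[k --> \oo] --> F U x.
Proof.
have [_ cU] := UU; rewrite cdfE (_ : (fun _ => _) = (fun k => 1 - mass (dens (U_ k)) `]x, +oo[)).
  by apply: cvgB; [exact: cvg_cst|exact: weak_cvg_density_mass].
by apply/funext => k; rewrite cdfE.
Qed.

(* A level [s] at which the quantile can jump is the value of [F U] at a
   rational point, hence the exceptional set is countable. *)
Lemma cvg_quantile (s : R) : 0 < s -> s < 1 ->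
  ~ (range (fun x : rat => F U (ratr x))) s -> q (U_ k) s @[k --> \oo] --> q U s.
Proof.
move=> s0 s1 sQ; have s0' := ltW s0; apply/cvgrPdist_le => e e0.
have Hup : \forall k \near \oo, q (U_ k) s <= q U s + e.
  have FU : s < F U (q U s + e).
    rewrite ltNge; apply/negP => H.
    have /andP[q0 _] := quantile_bounded U s0' s1.
    have := quantile_ge s0' s1 (addr_ge0 q0 (ltW e0)) H.
    by rewrite gerDl leNgt e0.
  have := @cvg_cdf (q U s + e) => /cvgr_gt/(_ _ FU); apply: filterS => k Fk.
  exact: quantile_le.
have Hlo : \forall k \near \oo, q U s - e <= q (U_ k) s.
  have [qe|qe] := leP (q U s - e) 0.
    near=> k; apply: le_trans qe _.
    by have /andP[] := quantile_bounded (U_ k) s0' s1.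
  have qlt : q U s - e < q U s by rewrite gtrBl.
  have [x] := rat_in_itvoo qlt.
  rewrite in_itv/= => /andP[xe xq].
  have Fx : F U (ratr x) < s.
    rewrite lt_neqAle; apply/andP; split; first by apply/eqP => E; apply: sQ; exists x.
    rewrite leNgt; apply/negP => /(quantile_le s0'); rewrite leNgt xq//.
  have := @cvg_cdf (ratr x) => /cvgr_lt/(_ _ Fx); apply: filterS => k Fk.
  apply: le_trans (ltW xe) _; apply: quantile_ge => //; last exact: ltW.
  exact: le_trans (ltW qe) (ltW xe).
near=> k; have a : q (U_ k) s <= q U s + e by near: k.
have b : q U s - e <= q (U_ k) s by near: k.
by rewrite ler_norml; apply/andP; split; lra.
Unshelve. all: by end_near. Qed.

(** Genuine continuity holds, and not only semicontinuity, because the convergent radii are bounded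
    and hence dominate all the quantiles at once. *)
Lemma cvg_W2_sqr (V : state) : W2_sqr V (U_ k) @[k --> \oo] --> W2_sqr V U.
Proof.
have [cr _] := UU.
have [M HM] : exists M, forall k, ball_radius (U_ k) <= M.
  have /cvg_seq_bounded[M [_ HM]] : cvgn (fun k => ball_radius (U_ k)) by exact: cvgP cr.
  exists (M + 1) => k; apply: le_trans (ler_norm _) _; apply: HM => //; rewrite ltrDl//.
pose K := Num.max M (Num.max (ball_radius V) (ball_radius U)).
have Kk k : ball_radius (U_ k) <= K by rewrite le_max HM.
have KV : ball_radius V <= K by rewrite !le_max lexx !orbT.
have K0 : 0 <= K by exact: le_trans (ball_radius_ge0 V) KV.
have cQ : countable (range (fun x : rat => F U (ratr x))).
  by apply: (sub_countable (card_image_le _ _)); exact: countableP.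
have := @dominated_convergence _ _ R mu `](0:R), 1[ (measurable_itv _)
  (fun k s => (`|q V s - q (U_ k) s| ^+ 2)%:E) (fun s => (`|q V s - q U s| ^+ 2)%:E)
  (fun=> (K ^+ 2)%:E).
case=> //.
- move=> k; apply/measurable_EFinP; apply: measurable_funX; exact: measurable_qdiff.
- apply/measurable_EFinP; apply: measurable_funX; exact: measurable_qdiff.
- exists (range (fun x : rat => F U (ratr x))); split.
  + by apply: countable_measurable => // t; exact: measurable_set1.
  + exact: countable_lebesgue_measure0.
  + move=> s /= H; apply: contrapT => sQ; apply: H; rewrite in_itv/= => /andP[s0 s1].
    apply: cvg_EFin; first by near=> k.
    apply: (@cvg_comp _ _ _ (fun k => `|q V s - q (U_ k) s|) (fun x => x ^+ 2)).
      apply: cvg_norm; apply: cvgB; [exact: cvg_cst|exact: cvg_quantile].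
    exact: exprn_continuous.
- apply: (@integrable_unit_itv (cst (K ^+ 2)) (K ^+ 2)) => //.
  by move=> s _ _; rewrite /= ger0_norm// exprn_ge0.
- apply: aeW => s k /=; rewrite in_itv/= => /andP[s0 s1].
  rewrite lee_fin normrX normr_id lerXn2r ?nnegrE//.
  exact: quantile_diff_le.
- move=> _ _; rewrite /W2_sqr /Rintegral => H.
  have fin (W : state) : (\int[mu]_(s in `]0%R, 1%R[) (`|q V s - q W s| ^+ 2)%:E)%E \is a fin_num.
    exact: integrable_fin_num (integrable_qdiff_sqr V W).
  by move: H; rewrite -{1}(fineK (fin U)) => /fine_cvgP[].
Unshelve. all: by end_near. Qed.

End Continuity.

(** * The weighted distance between radii *)

Section Radius.

Let sqrtP x := Num.sqrt (P x).

Let continuous_sqrtP : continuous sqrtP.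
Proof.
move=> x; apply: (@continuous_comp R R R P Num.sqrt); first exact: continuous_perim.
exact: sqrt_continuous.
Qed.

Let integrable_sqrtP (a b : R) : mu.-integrable `[a, b] (EFin \o sqrtP).
Proof.
apply: continuous_compact_integrable; first exact: segment_compact.
by apply: continuous_subspaceT; exact: continuous_sqrtP.
Qed.

Let integrable_cst_segment (a b c : R) : mu.-integrable `[a, b] (EFin \o (fun=> c)).
Proof.
apply: continuous_compact_integrable; first exact: segment_compact.
by apply: continuous_subspaceT => x; exact: cvg_cst.
Qed.

(** A primitive of the square root of P_n; the distance of radii is |G s - G r|, whence the triangle
    inequality. *)
Let G (r : R) := \int[mu]_(x in `[0, r]) sqrtP x.

Let dist_radiusE (r s : R) : 0 <= r -> r <= s -> dist_radius n r s = G s - G r.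
Proof.
move=> r0 rs; have s0 := le_trans r0 rs.
rewrite /dist_radius min_l// max_r// ger0_norm; last first.
  by apply: Rintegral_ge0 => x _; exact: sqrtr_ge0.
rewrite /G Rintegral_itvB; [|exact: integrable_sqrtP|by rewrite bnd_simp..].
rewrite -Rintegral_itv_obnd_cbnd//.
by apply: integrableS (integrable_sqrtP 0 s) => //; apply: subset_itvr; rewrite bnd_simp.
Qed.

Lemma dist_radiusC (r s : R) : dist_radius n r s = dist_radius n s r.
Proof. by rewrite /dist_radius minC maxC. Qed.

Let dist_radius_abs (r s : R) : 0 <= r -> 0 <= s -> dist_radius n r s = `|G s - G r|.
Proof.
move=> r0 s0; have [rs|sr] := leP r s.
  by rewrite dist_radiusE// ger0_norm// -dist_radiusE//; exact: normr_ge0.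
rewrite dist_radiusC distrC dist_radiusE ?(ltW sr)// ger0_norm// -dist_radiusE ?(ltW sr)//.
exact: normr_ge0.
Qed.

Lemma dist_radius_ge0 (r s : R) : 0 <= dist_radius n r s.
Proof. exact: normr_ge0. Qed.

Lemma dist_radius_triangle (r s t : R) : 0 <= r -> 0 <= s -> 0 <= t ->
  dist_radius n r t <= dist_radius n r s + dist_radius n s t.
Proof.
move=> r0 s0 t0; rewrite !dist_radius_abs// [leRHS]addrC; exact: ler_distD.
Qed.

Lemma dist_radiusxx (r : R) : 0 <= r -> dist_radius n r r = 0.
Proof. by move=> r0; rewrite dist_radius_abs// subrr normr0. Qed.

Lemma dist_radius_le (r s M : R) : 0 <= r -> 0 <= s -> r <= M -> s <= M ->
  dist_radius n r s <= `|r - s| * Num.sqrt (P M).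
Proof.
wlog rs : r s / r <= s.
  move=> H r0 s0 rM sM; have [/H|/ltW/H] := leP r s; first exact.
  by rewrite dist_radiusC distrC; exact.
move=> r0 s0 rM sM; rewrite /dist_radius min_l// max_r// ger0_norm; last first.
  by apply: Rintegral_ge0 => x _; exact: sqrtr_ge0.
rewrite distrC ger0_norm ?subr_ge0//.
have -> : (s - r) * Num.sqrt (P M) = \int[mu]_(x in `[r, s]) (Num.sqrt (P M)).
  rewrite Rintegral_cst//= lebesgue_measure_itv/= lte_fin mulrC; congr (_ * _).
  by case: ltgtP rs => // -> _; rewrite subrr.
apply: le_Rintegral; [by []|exact: (integrable_sqrtP r s)|exact: integrable_cst_segment|].
move=> x /=; rewrite in_itv/= => /andP[rx xs]; rewrite ler_wsqrtr// le_perim//.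
  exact: le_trans rx.
exact: le_trans sM.
Qed.

(** The weight degenerates at 0, so only the last piece [s - e/2, s] of the interval is used: if s -
    r >= e it lies in [r, s] and stays above e/2. *)
Lemma dist_radius_separates (e : R) : 0 < n%:R * @omega R n -> 0 < e ->
  exists2 d : R, 0 < d & forall r s, 0 <= r -> 0 <= s -> dist_radius n r s < d -> `|r - s| < e.
Proof.
move=> om e0; have e20 : 0 < e / 2 by rewrite divr_gt0.
have Pe : 0 < P (e / 2) by rewrite /perim mulr_gt0// exprn_gt0.
exists (e / 2 * Num.sqrt (P (e / 2))); first by rewrite mulr_gt0// sqrtr_gt0.
move=> r s; wlog rs : r s / r <= s.
  move=> H r0 s0; have [/H|/ltW/H] := leP r s; first exact.
  by rewrite dist_radiusC distrC; exact.
move=> r0 s0; apply: contraTT; rewrite -!leNgt distrC ger0_norm ?subr_ge0// => es.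
rewrite /dist_radius min_l// max_r// ger0_norm; last first.
  by apply: Rintegral_ge0 => x _; exact: sqrtr_ge0.
have -> : e / 2 * Num.sqrt (P (e / 2)) =
    \int[mu]_(x in `[s - e / 2, s]) (Num.sqrt (P (e / 2))).
  rewrite Rintegral_cst//= lebesgue_measure_itv/= lte_fin gtrBl e20 mulrC; congr (_ * _).
  by rewrite /= opprB addrC subrK.
have sub : `[s - e / 2, s] `<=` `[r, s].
  by move=> x /=; rewrite !in_itv/= => /andP[a ->]; rewrite andbT; lra.
apply: (@le_trans _ _ (\int[mu]_(x in `[s - e / 2, s]) sqrtP x)).
  apply: le_Rintegral; [by []|exact: integrable_cst_segment|exact: integrable_sqrtP|].
  move=> x /=; rewrite in_itv/= => /andP[a b]; rewrite ler_wsqrtr// le_perim ?(ltW e20)//; lra.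
rewrite /Rintegral fine_le//; [exact: integrable_fin_num (integrable_sqrtP _ _)..|].
apply: ge0_subset_integral => //.
- exact: measurable_int (integrable_sqrtP r s).
- by move=> x _; rewrite lee_fin sqrtr_ge0.
Qed.

Lemma cvg_dist_radius (r : R) (s_ : nat -> R) (s : R) : 0 <= r -> (forall k, 0 <= s_ k) ->
  s_ k @[k --> \oo] --> s -> dist_radius n r (s_ k) @[k --> \oo] --> dist_radius n r s.
Proof.
move=> r0 sk0 cs.
have s0 : 0 <= s.
  by rewrite -(cvg_lim (@Rhausdorff R) cs); apply: limr_ge; [exact: cvgP cs|near=> k].
apply/cvgrPdist_le => e e0; pose M := s + 1.
have c0 : 0 < Num.sqrt (P M) + 1 by rewrite ltr_wpDl// sqrtr_ge0.
have e'0 : 0 < e / (Num.sqrt (P M) + 1) by rewrite divr_gt0.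
have /cvgrPdist_lt H := cs.
near=> k.
have d1 : `|s - s_ k| < 1 by near: k; exact: H.
have d2 : `|s - s_ k| < e / (Num.sqrt (P M) + 1) by near: k; exact: H.
have skM : s_ k <= M by move: d1; rewrite ltr_norml /M => /andP[? _]; lra.
have sM : s <= M by rewrite /M lerDl.
apply: (@le_trans _ _ (dist_radius n s (s_ k))).
  have T1 := dist_radius_triangle r0 s0 (sk0 k).
  have T2 := dist_radius_triangle r0 (sk0 k) s0.
  rewrite (dist_radiusC (s_ k)) in T2.
  by rewrite ler_norml; apply/andP; split; lra.
apply: le_trans (dist_radius_le s0 (sk0 k) sM skM) _.
rewrite -[leRHS](@divfK _ (Num.sqrt (P M) + 1)) ?gt_eqF//.
by apply: ler_pM; rewrite ?sqrtr_ge0 ?(ltW d2) ?lerDl.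
Unshelve. all: by end_near. Qed.

End Radius.

Lemma cvg_state_dist_sqr (kappa : R) (V : state) (U_ : nat -> state) (U : state) :
  weak_cvg U_ U ->
  state_dist_sqr kappa V (U_ k) @[k --> \oo] --> state_dist_sqr kappa V U.
Proof.
move=> UU; apply: cvgD; last first.
  by apply: cvgMr_tmp; exact: cvg_W2_sqr.
apply: (@cvg_comp _ _ _ _ (fun x : R => x ^+ 2)); last exact: exprn_continuous.
by apply: cvg_dist_radius; [exact: ball_radius_ge0|move=> k; exact: ball_radius_ge0|case: UU].
Qed.

Lemma state_dist_sqrxx (kappa : R) (U : state) : state_dist_sqr kappa U U = 0.
Proof.
by rewrite /state_dist_sqr dist_radiusxx ?ball_radius_ge0// W2_sqrxx mul0r addr0 expr0n.
Qed.

End Metric.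

(** * Existence of discrete solutions *)

Section DiagonalExtraction.
Context {R : realType}.

Lemma bounded_diagonal_subsequence (x : nat -> nat -> R) (B : nat -> R) :
  (forall k i, `|x k i| <= B i) ->
  exists2 phi : nat -> nat, (forall k, (k <= phi k)%N) &
    forall i, cvgn (fun k => x (phi k) i).
Proof.
move=> xB.
have BW (a : nat * (nat -> nat)) : exists psi : nat -> nat,
    increasing_seq psi /\ cvgn (fun k => x (a.2 (psi k)) a.1).
  have [|psi psi_inc cpsi] := @bolzano_weierstrass R (fun k => x (a.2 k) a.1).
    exists (B a.1); split; first by rewrite num_real.
    by move=> y By k _; exact: le_trans (xB _ _) (ltW By).
  by exists psi.
have [psi Hpsi] := choice BW.
(* [Phi i] composes the first [i] extractions; each later one factors through it, so from index i +
   1 on the diagonal runs inside the extraction that makes coordinate [i] converge. *)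
pose Phi := fix Phi (i : nat) : nat -> nat :=
  if i is i'.+1 then Phi i' \o psi (i', Phi i') else id.
have psi_ge a k : (k <= psi a k)%N.
  have [mono_psi _] := Hpsi a.
  elim: k => // k; move/leq_ltn_trans; apply.
  by have := leW_mono mono_psi k k.+1; rewrite /Order.lt/= ltnS leqnn.
have Phi_inc i : {mono Phi i : a b / (a <= b)%N}.
  elim: i => [//|i IH] a b /=; rewrite IH.
  by have [mono_psi _] := Hpsi (i, Phi i); exact: mono_psi.
have Phi_factor j i : exists2 g : nat -> nat, (forall m, (m <= g m)%N) &
    Phi (i + j)%N =1 Phi j \o g.
  elim: i => [|i [g g_ge Eg]]; first by exists id.
  exists (g \o psi ((i + j)%N, Phi (i + j)%N)).
    by move=> m; apply: leq_trans (g_ge _); exact: psi_ge.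
  by move=> m; rewrite /= Eg.
exists (fun k => Phi k k).
  elim=> // k; move/leq_ltn_trans; apply; rewrite /=.
  apply: (@leq_trans (Phi k k.+1)); last by rewrite Phi_inc psi_ge.
  by rewrite ltnNge Phi_inc -ltnNge.
move=> i; have [_ /=] := Hpsi (i, Phi i); set y := (fun k => x _ _) => cy.
apply: cvgP (limn y) _; apply/cvgrPdist_le => e e0.
move/cvgrPdist_le : cy => /(_ _ e0) [N _ HN].
near=> k.
have ik : (i.+1 <= k)%N by near: k; exact: nbhs_infty_ge.
have Nk : (N <= k)%N by near: k; exact: nbhs_infty_ge.
have [g g_ge Eg] := Phi_factor i.+1 (k - i.+1)%N.
rewrite subnK// in Eg; rewrite Eg; apply: HN => /=.
exact: leq_trans (g_ge k).
Unshelve. all: by end_near. Qed.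

Lemma bounded_countable_subsequence (T : countType) (x : nat -> T -> R) (B : T -> R) :
  (forall k i, `|x k i| <= B i) ->
  exists2 phi : nat -> nat, (forall k, (k <= phi k)%N) &
    forall i, cvgn (fun k => x (phi k) i).
Proof.
move=> xB.
have [|phi phi_ge cphi] := @bounded_diagonal_subsequence
    (* Codes of no element of [T] get the constant sequence 0. *)
    (fun k p => oapp (x k) 0 (unpickle p)) (fun p => oapp B 0 (unpickle p)).
  by move=> k p; case: (unpickle p) => [i|] /=; [exact: xB|rewrite normr0].
by exists phi => // i; have := cphi (pickle i); rewrite pickleK.
Qed.

Lemma cvg_subsequence_ge (x : nat -> R) (l : R) (phi : nat -> nat) :
  (forall k, (k <= phi k)%N) -> x k @[k --> \oo] --> l -> x (phi k) @[k --> \oo] --> l.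
Proof.
move=> phi_ge cx; apply/cvgrPdist_le => e e0.
move/cvgrPdist_le : cx => /(_ _ e0) [N _ HN]; exists N => // k /= Nk.
by apply: HN => /=; exact: leq_trans (phi_ge k).
Qed.

End DiagonalExtraction.

Section Existence.
Context {R : realType} (n : nat) (f : R -> R) (kappa : R).
Hypotheses (n_gt1 : (1 < n)%N) (hf : admissible_energy n f) (kappa_gt0 : 0 < kappa).
Hypothesis omega_pos : 0 < n%:R * @omega R n.
Local Notation mu := (@lebesgue_measure R).
Local Notation P := (@perim R n).
Local Notation state := (state (R := R) n).
Local Notation dens U := (radial_mass_density n (profile U)).
Local Notation F U := (Defs.cdf n (profile U)).
Local Notation dist2 := (@state_dist_sqr R n kappa).

Lemma cdf_modulus (C e : R) : 0 < e -> exists2 d : R, 0 < d &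
  forall (U : state) (x y : R), (Phi f U <= C%:E)%E -> x <= y -> y - x < d ->
    F U y <= F U x + e.
Proof.
move=> e0; have [R0 R00 HR] := ball_radius_bounded n_gt1 hf omega_pos C.
have [d d0 Hd] := mass_unif_integrable hf HR R00 e0.
exists d => // U x y UC xy yxd.
have hw := is_density_radial U.
have E : mass (dens U) `]x, +oo[ = mass (dens U) `]x, y] + mass (dens U) `]y, +oo[.
  rewrite -massU//; first by rewrite -itv_bndbnd_setU//= bnd_simp.
  apply/disj_set2P/seteqP; split => // z [] /=; rewrite !in_itv/= andbT => /andP[_].
  by move=> /le_lt_trans/[apply]; rewrite ltxx.
have : mass (dens U) `]x, y] <= e.
  apply: Hd => //; apply: (@le_lt_trans _ _ (mu `]x, y])).
    by apply: le_measure; rewrite ?inE//; exact: measurableI.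
  rewrite lebesgue_measure_itv/= lte_fin; case: ifPn => _; last by rewrite lte_fin.
  by rewrite -EFinD lte_fin.
by rewrite !cdfE E; lra.
Qed.

Lemma cdf_cvg_rat (C : R) (U_ : nat -> state) : (forall k, (Phi f (U_ k) <= C%:E)%E) ->
  (forall y : rat, cvgn (fun k => F (U_ k) (ratr y))) ->
  forall x, cvgn (fun k => F (U_ k) x).
Proof.
move=> UC cF x; apply: cvgn_unif_approx => e e0.
have [d d0 Hd] := cdf_modulus C e0.
have xd : x < x + d by rewrite ltrDl.
have [y] := rat_in_itvoo xd; rewrite in_itv/= => /andP[xy yd].
exists (fun k => F (U_ k) (ratr y)) => //; near=> k.
rewrite distrC ger0_norm ?subr_ge0 ?le_cdf ?(ltW xy)// lerBlDl.
by apply: Hd; rewrite ?(ltW xy)//; lra.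
Unshelve. all: by end_near. Qed.

Lemma weak_compactness_subsequence (C : R) (U_ : nat -> state) :
  (forall k, (Phi f (U_ k) <= C%:E)%E) ->
  exists phi : nat -> nat, (forall k, (k <= phi k)%N) /\
    exists V : state, weak_cvg (fun k => U_ (phi k)) V.
Proof.
move=> UC; have [R0 R00 HR] := ball_radius_bounded n_gt1 hf omega_pos C.
(* [None] encodes the radius, so that one diagonal extraction treats it together with the
   distribution functions at rational radii. *)
pose x k (i : option rat) := if i is Some y then F (U_ k) (ratr y) else ball_radius (U_ k).
have [|phi phi_ge cphi] := @bounded_countable_subsequence R _ x (fun=> Num.max 1 R0).
  move=> k [y|] /=.
    by rewrite ger0_norm ?cdf_ge0// le_max cdf_le1.
  by rewrite ger0_norm ?ball_radius_ge0// le_max HR// orbT.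
exists phi; split => //; apply: (weak_compactness n_gt1 hf omega_pos (fun k => UC (phi k))).
  exact: (cphi None).
by apply: (@cdf_cvg_rat C) => // y; exact: (cphi (Some y)).
Qed.

Lemma Phi_fin_num (U : state) : (Phi f U < +oo)%E -> Phi f U \is a fin_num.
Proof.
move=> Uoo; have [C HC] := Phi_lbound n_gt1 hf omega_pos.
by rewrite fin_numE -ltNye -ltey Uoo andbT (lt_le_trans _ (HC U))// ltNyr.
Qed.

(** The direct method; the infimum is finite because [Phi] is bounded below and [U] itself is a
    competitor at distance 0. *)
Lemma minimizer_exists (U : state) (c : R) : (Phi f U < +oo)%E -> 0 < c ->
  exists V : state, forall W : state,
    (Phi f V + c%:E * state_dist kappa U V ^+ 2 <= Phi f W + c%:E * state_dist kappa U W ^+ 2)%E.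
Proof.
move=> Uoo c0; pose J W := (Phi f W + (c * dist2 U W)%:E)%E.
have JE W : (J W = Phi f W + c%:E * state_dist kappa U W ^+ 2)%E.
  by rewrite /J (state_distE U W kappa_gt0) EFinM.
suff [V HV] : exists V, forall W, (J V <= J W)%E.
  by exists V => W; rewrite -2!JE; exact: HV.
have [C0 HC0] := Phi_lbound n_gt1 hf omega_pos.
have D0 W : 0 <= c * dist2 U W by rewrite mulr_ge0 ?(ltW c0)// state_dist_sqr_ge0.
pose I := ereal_inf (range J).
have I_le W : (I <= J W)%E by apply: ereal_inf_lbound; exists W.
have Ifin : I \is a fin_num.
  rewrite fin_numE -ltNye -ltey; apply/andP; split.
    apply: (@lt_le_trans _ _ (- C0)%:E); first exact: ltNyr.
    apply: le_ereal_inf_tmp => _ [W _ <-]; apply: le_trans (HC0 W) _.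
    by rewrite leeDl// lee_fin.
  apply: le_lt_trans (I_le U) _.
  by rewrite /J state_dist_sqrxx mulr0 adde0.
pose i := fine I; have IE : I = i%:E by rewrite fineK.
have Wex k : exists W, (J W < (i + k.+1%:R^-1)%:E)%E.
  have ek : 0 < k.+1%:R^-1 :> R by rewrite invr_gt0.
  have [_ [W _ <-] HW] := lb_ereal_inf_adherent ek Ifin.
  by exists W; rewrite EFinD -IE.
have [W_ HW] := choice Wex.
(* The distance term is moved to the right, where it converges, so that closedness of the sublevels
   of [Phi] alone gives the conclusion. *)
have WC k : (Phi f (W_ k) <= (i + k.+1%:R^-1 - c * dist2 U (W_ k))%:E)%E.
  rewrite EFinB leeBrDr//; exact: ltW (HW k).
have WC1 k : (Phi f (W_ k) <= (i + 1)%:E)%E.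
  apply: le_trans (WC k) _; rewrite lee_fin; have := D0 (W_ k).
  have : k.+1%:R^-1 <= 1 :> R by rewrite invf_le1// ler1n.
  by move=> b1 a0; rewrite lerBlDr -addrA lerD2l (le_trans b1)// lerDl.
have [phi [phi_ge [V WV]]] := weak_compactness_subsequence WC1.
exists V => W; apply: le_trans (I_le W); rewrite IE.
suff : (Phi f V <= (i - c * dist2 U V)%:E)%E.
  by move=> H; rewrite /J -leeBrDr// -EFinB.
have cD : c * dist2 U (W_ (phi k)) @[k --> \oo] --> c * dist2 U V.
  by apply: cvgMl_tmp; exact: cvg_state_dist_sqr.
apply/lee_addgt0Pr => e e0; rewrite -EFinD.
apply: (Phi_lsc n_gt1 hf omega_pos WV).
have e20 : 0 < e / 2 by rewrite divr_gt0.
have ch : (phi k).+1%:R^-1 @[k --> \oo] --> (0 : R).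
  exact: (@cvg_subsequence_ge R (fun k => k.+1%:R^-1) 0 phi phi_ge (@cvg_harmonic R)).
move/cvgrPdist_le : cD => /(_ _ e20) H1; move/cvgrPdist_le : ch => /(_ _ e20) H2.
near=> k; apply: le_trans (WC (phi k)) _; rewrite lee_fin.
have h1 : `|c * dist2 U V - c * dist2 U (W_ (phi k))| <= e / 2 by near: k.
have h2 : `|0 - (phi k).+1%:R^-1| <= e / 2 :> R by near: k.
have aux (u v b : R) : `|u - v| <= e / 2 -> `|0 - b| <= e / 2 -> i + b - v <= i - u + e.
  by rewrite !ler_norml => /andP[? ?] /andP[? ?]; lra.
exact: aux h1 h2.
Unshelve. all: by end_near. Qed.

Definition minimizing_scheme (tau : R) (X : nat -> state) : Prop :=
  forall (k : nat) (W : state),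
    (Phi f (X k.+1) + ((2 * tau)^-1)%:E * state_dist kappa (X k) (X k.+1) ^+ 2
      <= Phi f W + ((2 * tau)^-1)%:E * state_dist kappa (X k) W ^+ 2)%E.

Let decrease (tau : R) (V W : state) :
  (Phi f W + ((2 * tau)^-1)%:E * state_dist kappa V W ^+ 2 <=
   Phi f V + ((2 * tau)^-1)%:E * state_dist kappa V V ^+ 2)%E ->
  (Phi f W + ((2 * tau)^-1 * dist2 V W)%:E <= Phi f V)%E.
Proof.
have aux (pV pW a b : \bar R) (c x : R) : a = x%:E -> b = 0%E ->
    (pW + c%:E * a <= pV + c%:E * b)%E -> (pW + (c * x)%:E <= pV)%E.
  by move=> -> ->; rewrite mule0 adde0 EFinM.
apply: aux; first exact: state_distE.
by rewrite state_distE// state_dist_sqrxx.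
Qed.

Let decrease_fin (tau : R) (V W : state) : 0 < tau -> (Phi f V < +oo)%E ->
  (Phi f W + ((2 * tau)^-1)%:E * state_dist kappa V W ^+ 2 <=
   Phi f V + ((2 * tau)^-1)%:E * state_dist kappa V V ^+ 2)%E -> (Phi f W < +oo)%E.
Proof.
move=> tau0 Voo /decrease H; apply: le_lt_trans Voo; apply: le_trans H.
rewrite leeDl// lee_fin mulr_ge0 ?state_dist_sqr_ge0//.
by rewrite invr_ge0 mulr_ge0// ltW.
Qed.

Lemma minimizing_scheme_exists (U0 : state) (tau : R) : (Phi f U0 < +oo)%E -> 0 < tau ->
  exists2 X : nat -> state, X 0%N = U0 & minimizing_scheme tau X.
Proof.
move=> U0oo tau0; have c0 : 0 < (2 * tau)^-1 by rewrite invr_gt0 mulr_gt0.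
(* The finiteness premise sits inside the existential so that choice yields a total step function;
   on states of infinite energy its value is arbitrary. *)
have stepE (V : state) : exists W : state, (Phi f V < +oo)%E -> forall V',
    (Phi f W + ((2 * tau)^-1)%:E * state_dist kappa V W ^+ 2
      <= Phi f V' + ((2 * tau)^-1)%:E * state_dist kappa V V' ^+ 2)%E.
  have [Voo|_] := boolP (Phi f V < +oo)%E; last by exists U0; discriminate.
  by have [W HW] := minimizer_exists Voo c0; exists W.
have [S HS] := choice stepE.
have Xoo k : (Phi f (iter k S U0) < +oo)%E.
  elim: k => [|k IH]; first exact: U0oo.
  exact: decrease_fin tau0 IH (HS _ IH _).
exists (fun k => iter k S U0); first by [].
by move=> k W; exact: (HS (iter k S U0) (Xoo k) W).
Qed.

(** * Dissipation estimate along a scheme *)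

Section DiscreteSolutions.
Variables (tau : R) (X : nat -> state).
Hypotheses (tau_gt0 : 0 < tau) (X0_fin : (Phi f (X 0%N) < +oo)%E).
Hypothesis X_min : minimizing_scheme tau X.

Lemma scheme_fin (k : nat) : (Phi f (X k) < +oo)%E.
Proof. by elim: k => [|k IH]; [exact: X0_fin|exact: decrease_fin tau_gt0 IH (X_min _ _)]. Qed.

Let p (k : nat) : R := fine (Phi f (X k)).

Let pE (k : nat) : Phi f (X k) = (p k)%:E.
Proof. by rewrite fineK// Phi_fin_num// scheme_fin. Qed.

Let p_step (k : nat) : dist2 (X k) (X k.+1) <= 2 * tau * (p k - p k.+1).
Proof.
have := decrease (X_min k (X k)); rewrite !pE -EFinD lee_fin.
have t0 : 0 < 2 * tau by rewrite mulr_gt0.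
rewrite mulrC -lerBrDl ler_pdivrMr// => H.
by rewrite mulrC.
Qed.

Lemma le_Phi_scheme (k : nat) : (Phi f (X k) <= Phi f (X 0%N))%E.
Proof.
elim: k => [|k IH]; first exact: lexx.
apply: le_trans IH; rewrite !pE lee_fin.
have := p_step k; have := state_dist_sqr_ge0 (X k) (X k.+1) kappa_gt0.
have t0 : 0 < 2 * tau by rewrite mulr_gt0.
move=> H1 H2; rewrite -subr_ge0 -(pmulr_rge0 _ t0); lra.
Qed.

(* The hypothesis with the free parameter [c], a form of Young's inequality, replaces
   the Cauchy-Schwarz inequality in the summation over the steps. *)
Lemma scheme_equicontinuous (ep : state -> state -> R) (B K : R) :
  0 <= B -> (forall U, ep U U = 0) ->
  (forall U V W, ep U W <= ep U V + ep V W) ->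
  (forall c U V, 0 < c -> ep U V <= c + B * (dist2 U V / c)) ->
  (forall k, fine (Phi f (X 0%N)) - fine (Phi f (X k)) <= K) ->
  forall (lambda : R) (a d : nat), 0 < lambda ->
    ep (X a) (X (a + d)%N) <= lambda * (tau * d%:R) + 2 * B * K / lambda.
Proof.
move=> B0 ep0 ep_tri ep_young HK lambda a d l0.
have lt0 : 0 < lambda * tau by rewrite mulr_gt0.
suff H : ep (X a) (X (a + d)%N) <= lambda * (tau * d%:R) + 2 * B * (p a - p (a + d)%N) / lambda.
  apply: le_trans H _; rewrite lerD2l ler_wpM2r ?invr_ge0 ?(ltW l0)// ler_wpM2l ?mulr_ge0//.
  apply: le_trans (HK (a + d)%N); rewrite lerD2r.
  by have := le_Phi_scheme a; rewrite !pE lee_fin.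
elim: d => [|d IH].
  by rewrite addn0 ep0 subrr !mulr0 mul0r addr0.
rewrite addnS; apply: le_trans (ep_tri _ (X (a + d)%N) _) _.
have S1 := ep_young _ (X (a + d)%N) (X (a + d).+1) lt0.
have S2 : B * (dist2 (X (a + d)%N) (X (a + d).+1) / (lambda * tau)) <=
    2 * B * (p (a + d)%N - p (a + d).+1) / lambda.
  have -> : 2 * B * (p (a + d)%N - p (a + d).+1) / lambda =
      B * (2 * tau * (p (a + d)%N - p (a + d).+1) / (lambda * tau)).
    by field; rewrite !gt_eqF.
  rewrite ler_wpM2l// ler_wpM2r ?invr_ge0 ?(ltW lt0)//.
have -> : lambda * (tau * d.+1%:R) + 2 * B * (p a - p (a + d).+1) / lambda =
    (lambda * (tau * d%:R) + 2 * B * (p a - p (a + d)%N) / lambda) +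
    (lambda * tau + 2 * B * (p (a + d)%N - p (a + d).+1) / lambda).
  by rewrite -natr1; field; rewrite gt_eqF.
lra.
Qed.

End DiscreteSolutions.
End Existence.

(** * Passage to the limit *)

Section MovementLimit.
Context {R : realType} (n : nat) (f : R -> R) (kappa : R).
Hypotheses (n_gt1 : (1 < n)%N) (hf : admissible_energy n f) (kappa_gt0 : 0 < kappa).
Hypothesis omega_pos : 0 < n%:R * @omega R n.
Local Notation P := (@perim R n).
Local Notation state := (state (R := R) n).
Local Notation F U := (Defs.cdf n (profile U)).
Local Notation dist2 := (@state_dist_sqr R n kappa).
Local Notation uniform_step j := (j.+1%:R^-1 : R).

(* For [0 <= t] this is the [k] with [t] in the [k]-th interval ]t^(k-1), t^k]. *)
Definition step_index (j : nat) (t : R) : nat := `|Num.ceil (t * j.+1%:R)|%N.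

Lemma node_uniform (j k : nat) : node (fun=> uniform_step j) k = k%:R * uniform_step j.
Proof. by rewrite /node sumr_const card_ord mulr_natl. Qed.

Lemma step_index_eq (j k : nat) (t : R) :
  k%:R * uniform_step j < t -> t <= k.+1%:R * uniform_step j -> step_index j t = k.+1.
Proof.
rewrite ltr_pdivrMr// ler_pdivlMr// => kt tk.
rewrite /step_index (@ceil_def _ _ k.+1%:Z)//.
have -> : k.+1%:Z - 1 = k%:Z by rewrite -addn1 PoszD addrK.
by apply/andP; split; [exact: kt|exact: tk].
Qed.

Lemma step_index_node (j k : nat) : step_index j (k%:R * uniform_step j) = k.
Proof. by rewrite /step_index divfK// -[k%:R]/(k%:Z%:~R) intrKceil. Qed.

(** Rounding both times up to nodes costs at most one additional step. *)
Lemma step_index_le (j : nat) (s t : R) : 0 <= s -> s <= t -> exists2 d,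
  step_index j t = (step_index j s + d)%N & uniform_step j * d%:R <= t - s + uniform_step j.
Proof.
move=> s0 st; have t0 := le_trans s0 st.
have j0 : 0 < j.+1%:R :> R by [].
have H x : 0 <= x -> (step_index j x)%:R = (Num.ceil (x * j.+1%:R))%:~R :> R.
  move=> x0; rewrite /step_index natr_absz ger0_norm// ceil_ge0//.
  by rewrite (lt_le_trans (ltrN10 _))// mulr_ge0.
have le : (step_index j s <= step_index j t)%N.
  by rewrite -(ler_nat R) !H// ler_int le_ceil// ler_wpM2r.
exists (step_index j t - step_index j s)%N; first by rewrite subnKC.
rewrite natrB// !H//.
have c1 : (Num.ceil (t * j.+1%:R))%:~R <= t * j.+1%:R + 1.
  by rewrite -lerBlDr ltW//; have := ceilB1_lt (t * j.+1%:R); rewrite intrB.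
have c2 : s * j.+1%:R <= (Num.ceil (s * j.+1%:R))%:~R by exact: ceil_ge.
rewrite mulrC ler_pdivrMr// mulrDl mulVf// mulrBl; lra.
Qed.

Variable U0 : state.
Hypothesis U0_fin : (Phi f U0 < +oo)%E.
Variable X : nat -> nat -> state.
Hypotheses (X0 : forall j, X j 0%N = U0)
  (X_min : forall j, minimizing_scheme f kappa (uniform_step j) (X j)).

Local Notation Ubar j t := (X j (step_index j t)).

Let step_gt0 (j : nat) : 0 < uniform_step j. Proof. by rewrite invr_gt0. Qed.

Let X_fin (j k : nat) : (Phi f (X j k) < +oo)%E.
Proof. by apply: (scheme_fin kappa_gt0 (step_gt0 j)) => //; rewrite X0. Qed.

Let C := fine (Phi f U0).

Let X_le (j k : nat) : (Phi f (X j k) <= C%:E)%E.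
Proof.
rewrite /C fineK ?(Phi_fin_num n_gt1 hf)// -(X0 j).
by apply: (le_Phi_scheme n_gt1 hf kappa_gt0 omega_pos (step_gt0 j)) => //; rewrite X0.
Qed.

(** The rational time does not depend on [j]: the equicontinuity estimate is uniform in [j] apart
    from one time step, which tends to 0. The abstract [ep] covers both the distance of radii and
    [W1]. *)
Lemma scheme_limit_rational (ep : state -> state -> R) (B t eta : R) :
  0 <= B -> (forall U, ep U U = 0) ->
  (forall U V W, ep U W <= ep U V + ep V W) ->
  (forall c U V, 0 < c -> ep U V <= c + B * (dist2 U V / c)) ->
  0 <= t -> 0 < eta -> exists q : rat, 0 <= ratr q :> R /\
    \forall j \near \oo, ep (Ubar j t) (Ubar j (ratr q)) <= eta.
Proof.
move=> B0 ep0 ep_tri ep_young t0 eta0.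
have [C0 HC0] := Phi_lbound n_gt1 hf omega_pos.
pose K := `|C + C0|.
have HK j k : fine (Phi f (X j 0%N)) - fine (Phi f (X j k)) <= K.
  apply: le_trans (ler_norm _); rewrite X0 lerD2l lerNl -lee_fin fineK//.
  exact: (Phi_fin_num n_gt1 hf omega_pos (X_fin j k)).
(* Makes the energy term 2BK/lambda at most eta/2. The time term is also at most eta/2, once q - t
   and the time step are each below eta/(4 lambda). *)
pose lambda := 2 * (2 * B * K + 1) / eta.
have BK : 0 <= 2 * B * K by apply: mulr_ge0; [exact: mulr_ge0|exact: normr_ge0].
have l0 : 0 < lambda by rewrite divr_gt0// mulr_gt0// ltr_wpDl.
have lK : 2 * B * K / lambda <= eta / 2.
  rewrite /lambda invf_div mulrA ler_pdivrMr ?mulr_gt0 ?ltr_wpDl//; nra.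
have e0 : 0 < eta / (4 * lambda) by rewrite divr_gt0// mulr_gt0.
have tq : t < t + eta / (4 * lambda) by rewrite ltrDl.
have [q] := rat_in_itvoo tq; rewrite in_itv/= => /andP[q1 q2].
exists q; split; first exact: le_trans (ltW q1).
have /cvgrPdist_le/(_ _ e0) := @cvg_harmonic R.
apply: filterS => j; rewrite sub0r normrN /harmonic/= ger0_norm// => je.
have [d -> Hd] := step_index_le j t0 (ltW q1).
have X0_fin : (Phi f (X j 0%N) < +oo)%E by rewrite X0.
have := scheme_equicontinuous n_gt1 hf kappa_gt0 omega_pos (step_gt0 j) X0_fin (X_min j)
  B0 ep0 ep_tri ep_young (HK j) (step_index j t) d l0.
move=> /le_trans; apply; rewrite [leRHS](splitr eta); apply: lerD => //.
apply: (@le_trans _ _ (lambda * (eta / (4 * lambda) + eta / (4 * lambda)))).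
  apply: ler_wpM2l; first exact: ltW.
  by apply: le_trans Hd _; apply: lerD => //; rewrite lerBlDl ltW.
rewrite le_eqVlt; apply/orP; left; apply/eqP; field.
by rewrite gt_eqF.
Qed.

Lemma radius_limit_rational (t e : R) : 0 <= t -> 0 < e -> exists q : rat, 0 <= ratr q :> R /\
  \forall j \near \oo, `|ball_radius (Ubar j t) - ball_radius (Ubar j (ratr q))| <= e.
Proof.
move=> t0 e0; have [d d0 Hd] := dist_radius_separates omega_pos e0.
pose ep (U V : state) := dist_radius n (ball_radius U) (ball_radius V).
have d20 : 0 < d / 2 by rewrite divr_gt0.
have [|||q [q0 Hq]] := @scheme_limit_rational ep 1 t (d / 2) ler01 _ _ _ t0 d20.
- by move=> U; exact/dist_radiusxx/ball_radius_ge0.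
- by move=> U V W; apply: dist_radius_triangle; exact: ball_radius_ge0.
- move=> c U V c0; rewrite mul1r.
  apply: (@le_trans _ _ (c + ep U V ^+ 2 / c)); last first.
    rewrite lerD2l ler_wpM2r ?invr_ge0 ?(ltW c0)// lerDl.
    by rewrite divr_ge0 ?W2_sqr_ge0// ltW.
  have : 0 <= ep U V by exact: dist_radius_ge0.
  move: (ep U V) => x x0; rewrite -(ler_pM2l c0) mulrDr mulrCA divff ?gt_eqF// mulr1.
  have := sqr_ge0 (x - c); have : 0 <= c * x by rewrite mulr_ge0// ltW.
  by rewrite sqrrB; lra.
- exists q; split => //; apply: filterS Hq => j Hj; apply/ltW/Hd; [exact: ball_radius_ge0..|].
  by apply: le_lt_trans Hj _; rewrite ltr_pdivrMr// ltr_pMr// ltr1n.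
Qed.

Lemma cdf_limit_rational (t e y : R) : 0 <= t -> 0 < e -> exists q : rat, 0 <= ratr q :> R /\
  \forall j \near \oo, `|F (Ubar j t) y - F (Ubar j (ratr q)) y| <= e.
Proof.
have aux (a b c w : R) : b <= a + e / 2 -> w <= e / 2 -> c <= b + w -> c - a <= e by lra.
move=> t0 e0; have e20 : 0 < e / 2 by rewrite divr_gt0.
have [d d0 Hd] := cdf_modulus n_gt1 hf omega_pos C e20.
have d20 : 0 < d / 2 by rewrite divr_gt0.
(* A shift of the radius by d/2 changes distribution functions of the sublevel by at most e/2, and
   this bound on [W1] divided by the shift gives the other e/2. *)
have eta0 : 0 < e / 2 * (d / 2) by rewrite mulr_gt0.
have [|||q [q0 Hq]] :=
  (* Here B = kappa, since the squared metric contains W_2^2 divided by kappa. *)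
  @scheme_limit_rational (@W1 R n) kappa t (e / 2 * (d / 2)) (ltW kappa_gt0) _ _ _ t0 eta0.
- exact: W1xx.
- exact: W1_triangle.
- move=> c U V c0; apply: le_trans (W1_le U V c0) _; rewrite lerD2l mulrA.
  rewrite ler_wpM2r ?invr_ge0 ?(ltW c0)// /state_dist_sqr mulrDr.
  rewrite [X in _ + X]mulrCA divff ?gt_eqF//.
  by rewrite mulr1 lerDr mulr_ge0 ?sqr_ge0// ltW.
- exists q; split => //; apply: filterS Hq => j Hj.
  have [y0|y0] := ltP y 0.
    by rewrite !cdf_npos ?(ltW y0)// subrr normr0 ltW.
  have key (U V : state) : (Phi f U <= C%:E)%E -> W1 U V <= e / 2 * (d / 2) ->
      F V y - F U y <= e.
    move=> UC UV; have := cdf_le_W1 U V y0 d20.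
    have : W1 U V / (d / 2) <= e / 2 by rewrite ler_pdivrMr.
    have := Hd U y (y + d / 2) UC; rewrite lerDl (ltW d20) addrAC subrr add0r.
    rewrite ltr_pdivrMr// ltr_pMr// ltr1n => /(_ isT isT).
    exact: aux.
  rewrite ler_norml lerNl opprB; apply/andP; split.
    exact: key (X_le _ _) Hj.
  by apply: (key _ _ (X_le _ _)); rewrite W1C; exact: Hj.
Qed.

Lemma scheme_subsequence_cvg : exists phi : nat -> nat, (forall k, (k <= phi k)%N) /\
  forall t, 0 <= t -> exists V : state, weak_cvg (fun k => Ubar (phi k) t) V.
Proof.
have [R0 R00 HR] := ball_radius_bounded n_gt1 hf omega_pos C.
pose x j (i : rat * option rat) := if i.2 is Some y then F (Ubar j (ratr i.1)) (ratr y)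
  else ball_radius (Ubar j (ratr i.1)).
have [|phi phi_ge cphi] := @bounded_countable_subsequence R _ x (fun=> Num.max 1 R0).
  move=> k [q [y|]] /=.
    by rewrite ger0_norm ?cdf_ge0// le_max cdf_le1.
  by rewrite ger0_norm ?ball_radius_ge0// le_max HR// orbT.
have near_phi (Q : nat -> Prop) : (\forall j \near \oo, Q j) -> \forall k \near \oo, Q (phi k).
  by move=> [N _ HN]; exists N => // k /= Nk; apply: HN => /=; exact: leq_trans (phi_ge k).
exists phi; split => // t t0.
apply: (weak_compactness n_gt1 hf omega_pos (fun k => X_le _ _)).
  apply: cvgn_unif_approx => e e0; have [q [q0 Hq]] := radius_limit_rational t0 e0.
  exists (fun k => ball_radius (Ubar (phi k) (ratr q)));
    [exact: (cphi (q, None))|exact: (near_phi _ Hq)].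
apply: (cdf_cvg_rat n_gt1 hf omega_pos (fun k => X_le _ _)) => y.
apply: cvgn_unif_approx => e e0; have [q [q0 Hq]] := cdf_limit_rational (ratr y) t0 e0.
exists (fun k => F (Ubar (phi k) (ratr q)) (ratr y));
  [exact: (cphi (q, Some y))|exact: (near_phi _ Hq)].
Qed.

Lemma time_steps_uniform (j : nat) : time_steps (fun=> uniform_step j).
Proof.
split => //.
- rewrite (_ : series _ = fun k => k%:R * uniform_step j); last first.
    by apply/funext => k; rewrite /series/= sumr_const_nat subn0 mulr_natl.
  apply/cvgryPge => A; near=> k.
  by rewrite ler_pdivlMr//; near: k; exact: nbhs_infty_ger.
- by exists (uniform_step j) => _ [k _ <-].
Unshelve. all: by end_near. Qed.

Lemma mesh_uniform (j : nat) : mesh (fun=> uniform_step j) = uniform_step j.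
Proof.
rewrite /mesh (_ : range _ = [set uniform_step j]) ?sup1//.
by apply/seteqP; split => [_ [k _ <-]//|_ ->]; exists 0%N.
Qed.

Lemma discrete_solution_scheme (j : nat) :
  discrete_solution kappa f (fun=> uniform_step j) (fun t => Ubar j t).
Proof.
split.
  move=> k s t; rewrite !node_uniform => ks sk kt tk.
  by rewrite (step_index_eq ks sk) (step_index_eq kt tk).
move=> k V; rewrite !node_uniform !step_index_node.
exact: X_min.
Qed.

End MovementLimit.

Theorem theorem2p8 (R : realType) (n : nat) (hn : (1 < n)%N)
    (kappa : R) (hkappa : 0 < kappa)
    (f : R -> R) (hf : admissible_energy n f)
    (U0 : state (R := R) n) (hU0 : (Phi f U0 < +oo)%E) :
  exists U : R -> state (R := R) n,
    generalized_minimizing_movement kappa f U0 U.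
Proof.
have om := omega_gt0 U0.
have schemes (j : nat) : exists Y : nat -> state (R := R) n,
    Y 0%N = U0 /\ minimizing_scheme f kappa (j.+1%:R^-1) Y.
  have j0 : 0 < j.+1%:R^-1 :> R by rewrite invr_gt0.
  by have [Y Y0 Ymin] := minimizing_scheme_exists hn hf hkappa om hU0 j0; exists Y.
have [X HX] := choice schemes.
have X0 j := (HX j).1; have X_min j := (HX j).2.
have [phi [phi_ge cphi]] := scheme_subsequence_cvg hn hf hkappa om hU0 X0 X_min.
(* At negative times the curve has no prescribed value and [U0] serves as the default witness. *)
have limits (t : R) : exists V : state (R := R) n, 0 <= t ->
    weak_cvg (fun k => X (phi k) (step_index (phi k) t)) V.
  have [t0|t0] := boolP (0 <= t); last by exists U0; discriminate.
  by have [V HV] := cphi t t0; exists V.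
have [U HU] := choice limits.
(* Every discrete solution starts exactly at [U0], so the conditions on the initial data concern
   constant sequences. *)
have Ubar0 j : X (phi j) (step_index (phi j) (0 : R)) = U0.
  by rewrite /step_index mul0r ceil0 X0.
exists U, (fun j _ => (phi j).+1%:R^-1), (fun j t => X (phi j) (step_index (phi j) t)).
split; last exact: HU.
- by move=> j; split; [exact: time_steps_uniform|exact: discrete_solution_scheme].
- under eq_fun do rewrite mesh_uniform.
  exact: (@cvg_subsequence_ge R (fun k => k.+1%:R^-1) 0 phi phi_ge (@cvg_harmonic R)).
- under eq_fun do rewrite Ubar0.
  exact: cvg_cst.
- under eq_fun do rewrite Ubar0.
  rewrite is_cvg_limn_esupE; last exact: is_cvg_cst.
  rewrite lim_cst// /state_dist W2_sqrE -EFinM -EFinD.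
  by rewrite poweR_lty// ltry.
Qed.
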